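(* Assume that $r\le c_0\sqrt n$ for some sufficiently small constant $c_0$. Then $$\inf_{\hat U}\ \sup_{\mathcal P(\lambda,n,L,\sigma)}\ \mathbb E\|\sin\Theta(\hat U,U)\|_F^2\ \gtrsim\ \frac{\sigma^2nr}{\lambda^2L}\wedge r,$$ where the infimum is taken over all estimators $\hat U$ on the basis of the observation $\{A^{(l)}\}_{l=1}^L$ under GOE noise with variance $\sigma^2$.
   Context: Model: one observes $A^{(l)}=S^{(l)}+N^{(l)}\in\mathbb R^{n\times n}$, $l=1,\dots,L$, with $N^{(1)},\dots,N^{(L)}$ independent. ''GOE noise with variance $\sigma^2$'' means each $N^{(l)}$ is symmetric with independent mean-zero Gaussian entries on and above the diagonal, of variance $\sigma^2$ on the diagonal and $\sigma^2/2$ off the diagonal. Parameter space: $$\mathcal P(\lambda,n,L,\sigma)=\Big\{\{S^{(l)}\}_{l=1}^L:\ S^{(l)}=UR^{(l)}U^\top,\ U\in\mathbb R^{n\times r},\ U^\top U=I_r,\ \lambda^2\le\lambda_{\min}\Big(\tfrac1L\sum_l(R^{(l)})^2\Big)\Big\},$$ where the $R^{(l)}\in\mathbb R^{r\times r}$ are symmetric. An estimator $\hat U$ takes values in $n\times r$ matrices with orthonormal columns. $\|\sin\Theta(U_1,U_2)\|_F=\|(U_1)_\perp^\top U_2\|_F$, where the columns of $(U_1)_\perp$ form an orthonormal basis of the orthogonal complement of the column space of $U_1$. $a\wedge b=\min\{a,b\}$, and $a\gtrsim b$ means $a\ge cb$ for a constant $c>0$. *)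

(* Defs.v *)
From HB Require Import structures.
From mathcomp Require Export all_boot all_order all_algebra.
From mathcomp Require Export all_classical all_reals all_analysis.

Set Implicit Arguments.
Unset Strict Implicit.
Unset Printing Implicit Defensive.

Import Order.TTheory GRing.Theory Num.Theory.
Import numFieldNormedType.Exports.

Local Open Scope classical_set_scope.
Local Open Scope ring_scope.

Section subspace_distance.
Variable R : realType.

Definition frobenius_norm (m n : nat) (M : 'M[R]_(m, n)) : R :=
  Num.sqrt (\sum_i \sum_j M i j ^+ 2).

(* The rows of [kermx U] span [{x | x *m U = 0}], which is the orthogonal
   complement of the column space of [U].  When [U] has orthonormal columns,
   that complement has dimension [n - r], so suitable [V]s exist; one of them
   is chosen (and the default value 0 is not used). *)
Definition perp (n r : nat) (U : 'M[R]_(n, r)) : 'M[R]_(n, n - r) :=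
  xget 0 [set V : 'M[R]_(n, n - r) |
            V^T *m V = 1%:M /\ (V^T == kermx U)%MS].

Definition sin_theta_F (n r : nat) (U1 U2 : 'M[R]_(n, r)) : R :=
  frobenius_norm ((perp U1)^T *m U2).

(* Meaningful for symmetric matrices of positive size, for which the set of
   real eigenvalues is finite and nonempty. *)
Definition lambda_min (r : nat) (M : 'M[R]_r) : R :=
  inf [set a : R | eigenvalue M a].

(* The parameter space, each signal [Sig] being paired with a matrix [U] that
   realizes it. For [lambda > 0], [Sig] determines the column space of [U], and
   [sin_theta_F] depends on [U] through that space only. *)
Definition param_space (n r L : nat) (lambda : R) :
    set (('I_L -> 'M[R]_n) * 'M[R]_(n, r)) :=
  [set SU | let: (Sig, U) := SU in
    U^T *m U = 1%:M /\
    exists Q : 'I_L -> 'M[R]_r,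
      [/\ forall l, (Q l)^T = Q l,
          forall l, Sig l = U *m Q l *m U^T
        & lambda ^+ 2 <= lambda_min (L%:R^-1 *: \sum_(l < L) (Q l *m Q l))]].

End subspace_distance.

Section noise.
Context d (T : measurableType d) (R : realType) (P : probability T R).

Definition mutual_independence (I : finType) (F : I -> set (set T)) : Prop :=
  forall (J : {set I}) (A : I -> set T),
    (forall i, i \in J -> F i (A i)) ->
    P (\bigcap_(i in [set` J]) A i) = (\prod_(i in J) P (A i))%E.

(* [normal_prob] takes the standard deviation, hence the square root. *)
Definition centered_gaussian (v : R) (X : T -> R) : Prop :=
  measurable_fun setT X /\
  forall B : set R, measurable B ->
    P (X @^-1` B) = normal_prob 0 (Num.sqrt v) B.

Definition upper_index (n : nat) := {ij : 'I_n * 'I_n | (ij.1 <= ij.2)%N}.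

Definition GOE (n : nat) (sigma : R) (N : T -> 'M[R]_n) : Prop :=
  [/\ forall w, (N w)^T = N w,
      forall i j : 'I_n, (i <= j)%N ->
        centered_gaussian (if i == j then sigma ^+ 2 else sigma ^+ 2 / 2)
          (fun w => N w i j)
    & mutual_independence (fun k : upper_index n =>
        preimage_set_system setT (fun w => N w (val k).1 (val k).2)
          (@measurable _ R))].

Definition sigma_algebra_of_mx (n : nat) (N : T -> 'M[R]_n) : set (set T) :=
  <<s \bigcup_(ij in [set: 'I_n * 'I_n])
        preimage_set_system setT (fun w => N w ij.1 ij.2) (@measurable _ R) >>.

Definition GOE_noise (n L : nat) (sigma : R) (N : 'I_L -> T -> 'M[R]_n) :
    Prop :=
  (forall l, GOE sigma (N l)) /\
  mutual_independence (fun l => sigma_algebra_of_mx (N l)).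

End noise.

Section minimax.
Variable R : realType.

(* Cylinder sets: they generate the Borel sigma-algebra of (R^(n x n))^L. *)
Definition obs_cylinders (n L : nat) : set (set ('I_L -> 'M[R]_n)) :=
  \bigcup_(k in [set: 'I_L * ('I_n * 'I_n)])
    preimage_set_system setT
      (fun A : 'I_L -> 'M[R]_n => A k.1 k.2.1 k.2.2) (@measurable _ R).

Definition estimators (n r L : nat) :
    set (('I_L -> 'M[R]_n) -> 'M[R]_(n, r)) :=
  [set Uhat : ('I_L -> 'M[R]_n) -> 'M[R]_(n, r) |
    (forall A, (Uhat A)^T *m Uhat A = 1%:M) /\
    forall i j, measurable_fun [set: g_sigma_algebraType (@obs_cylinders n L)]
      (fun A : g_sigma_algebraType (@obs_cylinders n L) => Uhat A i j : R)].

Definition risk d (T : measurableType d) (P : probability T R) (n r L : nat)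
    (N : 'I_L -> T -> 'M[R]_n) (Uhat : ('I_L -> 'M[R]_n) -> 'M[R]_(n, r))
    (Sig : 'I_L -> 'M[R]_n) (U : 'M[R]_(n, r)) : \bar R :=
  ('E_P[(fun w => sin_theta_F (Uhat (fun l => Sig l + N l w)) U ^+ 2)%R])%E.

Definition minimax_risk d (T : measurableType d) (P : probability T R)
    (n r L : nat) (N : 'I_L -> T -> 'M[R]_n) (lambda : R) : \bar R :=
  ereal_inf [set ereal_sup [set risk P N Uhat SU.1 SU.2
                               | SU in @param_space R n r L lambda]
               | Uhat in @estimators n r L].

End minimax.

(* Main.v *)
(* Assouad's method on the signals S^(l) = lambda P_Y, l = 1, ..., L, where P_Y
   is the orthogonal projection onto the graph {(x, Y x)} of Y = b W, with W an
   m x r sign matrix and m = n - r.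
   Two properties of Y |-> P_Y are used. It is Lipschitz for the Frobenius norm,
   so that flipping one sign of W moves the L signals by a total squared distance
   O(L lambda^2 b^2), which is O(sigma^2) for b^2 of order
   min(sigma^2 / (lambda^2 L), 1 / n): neighbouring hypotheses cannot be told
   apart. It is also bi-Lipschitz where the operator norm of Y is at most 1; as
   r^2 is small compared with n, the off-diagonal part of W^T W is small for most
   sign matrices (second moment and Markov), and these satisfy the bound. On them
   the loss dominates b^2 times the Hamming distance, and there are m r signs.
   The indistinguishability is obtained from the Gaussian shift formula
   E f(S + N) = E (f(N) Z_S(N)), Z_S being the exponential likelihood ratio,
   together with Z_S Z_S' = (Z_((S+S')/2) exp(-|S-S'|^2 / (8 sigma^2)))^2. *)
From HB Require Import structures.
Require Import Defs.
From mathcomp Require Import all_boot all_order all_algebra.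
From mathcomp Require Import all_classical all_reals all_analysis.
From mathcomp Require Import measurable_realfun zify ring lra.

Set Implicit Arguments.
Unset Strict Implicit.
Unset Printing Implicit Defensive.

Import Order.TTheory GRing.Theory Num.Theory.
Import numFieldNormedType.Exports.

Local Open Scope ring_scope.

(** * Frobenius inner product and the sine-theta distance *)

Section frobenius_inner_product.
Variable R : realType.

Definition mxdot (m n : nat) (A B : 'M[R]_(m, n)) : R := \tr (A^T *m B).

Definition sqn (m n : nat) (A : 'M[R]_(m, n)) : R := mxdot A A.

(** [c] bounds the square of the operator norm; testing on vectors avoids defining that norm as a
    supremum. *)
Definition opbound (m n : nat) (c : R) (A : 'M[R]_(m, n)) : Prop :=
  forall v : 'cV[R]_n, sqn (A *m v) <= c * sqn v.

Lemma mxdotE m n (A B : 'M[R]_(m, n)) : mxdot A B = \sum_i \sum_j A i j * B i j.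
Proof.
rewrite /mxdot /mxtrace exchange_big; apply: eq_bigr => j _.
by rewrite mxE; apply: eq_bigr => i _; rewrite mxE.
Qed.

Lemma sqnE m n (A : 'M[R]_(m, n)) : sqn A = \sum_i \sum_j A i j ^+ 2.
Proof. by rewrite /sqn mxdotE. Qed.

Lemma sqn_ge0 m n (A : 'M[R]_(m, n)) : 0 <= sqn A.
Proof. by rewrite sqnE; do 2 (apply: sumr_ge0 => ? _); rewrite sqr_ge0. Qed.

Lemma sqn0 m n : sqn (0 : 'M[R]_(m, n)) = 0.
Proof. by rewrite /sqn /mxdot mulmx0 mxtrace0. Qed.

Lemma frobenius_sqr m n (A : 'M[R]_(m, n)) : frobenius_norm A ^+ 2 = sqn A.
Proof. by rewrite /frobenius_norm -sqnE sqr_sqrtr// sqn_ge0. Qed.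

Lemma sqn_eq0 m n (A : 'M[R]_(m, n)) : sqn A = 0 -> A = 0.
Proof.
rewrite sqnE => /eqP; rewrite psumr_eq0; last first.
  by move=> i _; apply: sumr_ge0 => j _; rewrite sqr_ge0.
move=> /allP A0; apply/matrixP => i j; rewrite mxE.
have := A0 i (mem_index_enum i); rewrite /= psumr_eq0 => [/allP/(_ j)|k _].
  by rewrite mem_index_enum => /(_ isT); rewrite sqrf_eq0 => /eqP.
exact: sqr_ge0.
Qed.

Lemma mxdotC m n (A B : 'M[R]_(m, n)) : mxdot A B = mxdot B A.
Proof. by rewrite /mxdot -mxtrace_tr trmx_mul trmxK. Qed.

Lemma mxdot_mull m n p (A : 'M[R]_(m, n)) (B : 'M[R]_(n, p)) (C : 'M[R]_(m, p)) :
  mxdot (A *m B) C = mxdot B (A^T *m C).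
Proof. by rewrite /mxdot trmx_mul mulmxA. Qed.

Lemma sqn_tr m n (A : 'M[R]_(m, n)) : sqn A^T = sqn A.
Proof. by rewrite /sqn /mxdot trmxK mxtrace_mulC. Qed.

Lemma sqn_lin m n (a b : R) (A B : 'M[R]_(m, n)) :
  sqn (a *: A + b *: B) = a ^+ 2 * sqn A + 2 * a * b * mxdot A B + b ^+ 2 * sqn B.
Proof.
rewrite /sqn !mxdotE !mulr_sumr -!big_split /=; apply: eq_bigr => i _.
rewrite !mulr_sumr -!big_split /=; apply: eq_bigr => j _.
by rewrite !mxE; ring.
Qed.

Lemma sqnB m n (A B : 'M[R]_(m, n)) :
  sqn (A - B) = sqn A - 2 * mxdot A B + sqn B.
Proof. by have := sqn_lin 1 (-1) A B; rewrite scale1r scaleN1r => ->; ring. Qed.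

Lemma sqnN m n (A : 'M[R]_(m, n)) : sqn (- A) = sqn A.
Proof. by have := sqn_lin (-1) 0 A 0; rewrite scaleN1r scale0r addr0 => ->; ring. Qed.

Lemma sqnZ m n a (A : 'M[R]_(m, n)) : sqn (a *: A) = a ^+ 2 * sqn A.
Proof. by have := sqn_lin a 0 A 0; rewrite scale0r addr0 => ->; ring. Qed.

Lemma sqnD_le m n (A B : 'M[R]_(m, n)) : sqn (A + B) <= 2 * (sqn A + sqn B).
Proof.
have := sqn_lin 1 1 A B; rewrite !scale1r => ->.
have := sqn_ge0 (A - B); rewrite sqnB; lra.
Qed.

Lemma sqn_col_mx m1 m2 n (A : 'M[R]_(m1, n)) (B : 'M[R]_(m2, n)) :
  sqn (col_mx A B) = sqn A + sqn B.
Proof. by rewrite /sqn /mxdot tr_col_mx mul_row_col mxtraceD. Qed.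

Lemma sqn_isometry m n p (U : 'M[R]_(m, n)) (A : 'M[R]_(n, p)) :
  U^T *m U = 1%:M -> sqn (U *m A) = sqn A.
Proof. by move=> UU; rewrite /sqn mxdot_mull mulmxA UU mul1mx. Qed.

(** Expand [|c v - A A^T v|^2 >= 0], where [<v, A A^T v> = |A^T v|^2] and
    [|A A^T v|^2 <= c |A^T v|^2], and cancel a factor [c]. *)
Lemma opbound_tr m n c (A : 'M[R]_(m, n)) : 0 < c -> opbound c A -> opbound c A^T.
Proof.
move=> c0 Ac v; have := sqn_ge0 (c *: v + (-1) *: (A *m (A^T *m v))).
rewrite sqn_lin; have := Ac (A^T *m v).
rewrite mxdotC mxdot_mull -/(sqn _) => h1 h2.
rewrite -(ler_pM2l c0); nra.
Qed.

Lemma sqn_mul_le m n p c (A : 'M[R]_(m, n)) (B : 'M[R]_(n, p)) :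
  opbound c A -> sqn (A *m B) <= c * sqn B.
Proof.
have sqn_cols k (C : 'M[R]_(k, p)) : sqn C = \sum_j sqn (col j C).
  rewrite sqnE exchange_big; apply: eq_bigr => j _; rewrite sqnE.
  by apply: eq_bigr => i _; rewrite big_ord1 mxE.
move=> Ac; rewrite !sqn_cols mulr_sumr; apply: ler_sum => j _.
by rewrite colE -mulmxA -colE.
Qed.

Lemma sqn_mulr_le m n p c (A : 'M[R]_(m, n)) (B : 'M[R]_(n, p)) :
  0 < c -> opbound c B -> sqn (A *m B) <= c * sqn A.
Proof.
move=> c0 Bc; rewrite -sqn_tr trmx_mul -(sqn_tr A).
exact/sqn_mul_le/opbound_tr.
Qed.

Lemma sqn_proj_le m p (Q : 'M[R]_m) (A : 'M[R]_(m, p)) :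
  Q^T = Q -> Q *m Q = Q -> sqn (Q *m A) <= sqn A.
Proof.
move=> QT QQ; have e : mxdot A (Q *m A) = sqn (Q *m A).
  by rewrite /sqn mxdot_mull QT mulmxA QQ.
by have := sqn_ge0 (A - Q *m A); rewrite sqnB e; lra.
Qed.

(** Gram-Schmidt on the rows, by induction on their number. Writing the result as [T *m A] keeps
    track of the row space. *)
Lemma exists_orthonormalization m n (A : 'M[R]_(m, n)) : row_free A ->
  exists T : 'M[R]_m, (T *m A) *m (T *m A)^T = 1%:M.
Proof.
elim: m A => [|m IH] A fA.
  by exists 1%:M; apply/matrixP => -[].
have eA : A = col_mx (usubmx (A : 'M[R]_(1 + m, n))) (dsubmx (A : 'M[R]_(1 + m, n))).
  by rewrite vsubmxK.
move: eA; set a := usubmx _; set B := dsubmx _ => eA.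
have fB : row_free B.
  apply: inj_row_free => v vB.
  have /eqP : row_mx (0 : 'M[R]_1) v *m (A : 'M[R]_(1 + m, n)) = 0.
    by rewrite eA mul_row_col mul0mx add0r.
  rewrite mulmx_free_eq0// => /eqP; rewrite -[RHS]row_mx0.
  by move/eq_row_mx => [].
have [T TB] := IH B fB.
have [C CE] : exists C, C = T *m B by exists (T *m B).
have CC : C *m C^T = 1%:M by rewrite CE.
(* [v] is the first row minus its projection on the rows of [C]; independence of the rows of [A]
   makes it nonzero, so that it can be normalized. *)
have [v vE] : exists v, v = a - a *m C^T *m C by exists (a - a *m C^T *m C).
have Cv : v *m C^T = 0 by rewrite vE mulmxBl -!mulmxA CC mulmx1 subrr.
have v0 : 0 < sqn v.
  rewrite lt0r sqn_ge0 andbT; apply/eqP => /sqn_eq0 v0.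
  have /eqP : row_mx (1%:M : 'M[R]_1) (- (a *m C^T *m T)) *m (A : 'M[R]_(1 + m, n)) = 0.
    by rewrite eA mul_row_col mul1mx mulNmx -(mulmxA _ T) -CE -vE.
  rewrite mulmx_free_eq0// => /eqP; rewrite -[RHS]row_mx0 => /eq_row_mx[+ _].
  by move/matrixP/(_ 0 0); rewrite !mxE => /eqP; rewrite oner_eq0.
pose c := (Num.sqrt (sqn v))^-1.
have vv : v *m v^T = (sqn v)%:M.
  by rewrite [LHS]mx11_scalar -trace_mx11 -sqn_tr /sqn /mxdot trmxK.
have cc : c * (c * sqn v) = 1.
  rewrite mulrA -expr2 exprVn sqr_sqrtr ?ltW// mulVf// gt_eqF//.
exists (col_mx (row_mx (c%:M) (- (c *: (a *m C^T *m T)))) (row_mx 0 T) : 'M[R]_(1 + m)).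
have -> : (col_mx (row_mx (c%:M) (- (c *: (a *m C^T *m T)))) (row_mx 0 T)
    : 'M[R]_(1 + m)) *m (A : 'M[R]_(1 + m, n)) = col_mx (c *: v) C.
  rewrite eA mul_col_mx !mul_row_col mul0mx add0r mul_scalar_mx -CE; congr col_mx.
  by rewrite mulNmx -scalemxAl -scalerBr -(mulmxA _ T) -CE vE.
have e11 : (c *: v) *m (c *: v)^T = 1%:M.
  by rewrite -scalemxAl linearZ /= -scalemxAr vv !scale_scalar_mx cc.
have e12 : (c *: v) *m C^T = 0 by rewrite -scalemxAl Cv scaler0.
have e21 : C *m (c *: v)^T = 0 by rewrite -(trmxK C) -trmx_mul e12 trmx0.
have key : col_mx (c *: v) C *m (col_mx (c *: v) C)^T = 1%:M.
  by rewrite tr_col_mx mul_col_row CC e11 e12 e21 -scalar_mx_block.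
exact: key.
Qed.

Lemma orthonormal_rank n r (U : 'M[R]_(n, r)) : U^T *m U = 1%:M -> \rank U = r.
Proof.
move=> UU; apply/eqP; rewrite eqn_leq rank_leq_col /=.
by rewrite -[X in (X <= _)%N](mxrank1 R) -UU mxrankM_maxr.
Qed.

(** The choice made by [xget] is a genuine one: the kernel has dimension [n - r], and a row basis of
    it can be orthonormalized. *)
Lemma perpP n r (U : 'M[R]_(n, r)) : U^T *m U = 1%:M ->
  (perp U)^T *m perp U = 1%:M /\ ((perp U)^T == kermx U)%MS.
Proof.
move=> UU; rewrite /perp; case: xgetP => [V _ //|noV]; exfalso.
have rk : \rank (kermx U) = (n - r)%N by rewrite mxrank_ker orthonormal_rank.
have [A [fA AU]] : exists A : 'M[R]_(n - r, n), row_free A /\ (A == kermx U)%MS.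
  rewrite -rk; exists (row_base (kermx U)); split; first exact: row_base_free.
  by apply/eqmxP; exact: eq_row_base.
have [T TA] := exists_orthonormalization fA.
have uT : T \in unitmx.
  by move: TA; rewrite -mulmxA => /mulmx1_unit[].
apply: (noV (T *m A)^T); split; rewrite trmxK//.
apply/eqmxP/(eqmx_trans _ (eqmxP AU)).
by apply: eqmxMfull; rewrite row_full_unit.
Qed.

(** The transpose of the square matrix [row_mx V U] is a left inverse of it, hence also a right
    inverse. *)
Lemma orthonormal_completion n k r (V : 'M[R]_(n, k)) (U : 'M[R]_(n, r)) :
  (k + r)%N = n -> V^T *m V = 1%:M -> U^T *m U = 1%:M -> V^T *m U = 0 ->
  V *m V^T + U *m U^T = 1%:M.
Proof.
move=> nE; subst n => VV UU VU.
have UV : U^T *m V = 0 by rewrite -(trmxK V) -trmx_mul VU trmx0.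
rewrite -mul_row_col -tr_row_mx; apply: mulmx1C.
by rewrite tr_row_mx mul_col_row VV UU VU UV -scalar_mx_block.
Qed.

(** Pythagoras for the splitting of [U2] along the column space of [U1] and its complement. Later
    arguments are thereby freed from the chosen basis [perp]. *)
Lemma sin_theta_sqr n r (U1 U2 : 'M[R]_(n, r)) : (r <= n)%N ->
  U1^T *m U1 = 1%:M ->
  sin_theta_F U1 U2 ^+ 2 = sqn U2 - sqn (U1^T *m U2).
Proof.
move=> rn UU; rewrite /sin_theta_F frobenius_sqr.
have [VV /eqmxP VU] := perpP UU.
have VU0 : (perp U1)^T *m U1 = 0.
  by apply/sub_kermxP; rewrite -VU.
have := orthonormal_completion (subnK rn) VV UU VU0.
move: (perp U1) => V PE; rewrite /sqn !mxdot_mull !trmxK !mulmxA.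
apply/esym/eqP; rewrite subr_eq; apply/eqP.
rewrite -[X in mxdot _ X = _]mul1mx -PE mulmxDl.
by rewrite /mxdot mulmxDr mxtraceD.
Qed.

Lemma orthonormal_leq n r (U : 'M[R]_(n, r)) : U^T *m U = 1%:M -> (r <= n)%N.
Proof. by move=> /orthonormal_rank <-; exact: rank_leq_row. Qed.

(** The cross term is [|U1^T U2|^2] by cyclicity of the trace. As a squared distance between
    projections, the loss obeys a triangle inequality up to a factor. *)
Lemma sin_theta_proj_dist n r (U1 U2 : 'M[R]_(n, r)) :
  U1^T *m U1 = 1%:M -> U2^T *m U2 = 1%:M ->
  sqn (U1 *m U1^T - U2 *m U2^T) = 2 * sin_theta_F U1 U2 ^+ 2.
Proof.
move=> UU1 UU2; rewrite sin_theta_sqr//; last exact: orthonormal_leq UU1.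
rewrite sqnB (sqn_isometry _ UU1) (sqn_isometry _ UU2) !sqn_tr.
have -> : mxdot (U1 *m U1^T) (U2 *m U2^T) = sqn (U1^T *m U2).
  rewrite /sqn /mxdot !trmx_mul !trmxK [LHS]mxtrace_mulC.
  by rewrite !mulmxA [RHS]mxtrace_mulC !mulmxA.
have -> : sqn U1 = sqn U2 by rewrite /sqn /mxdot UU1 UU2.
ring.
Qed.

Lemma sin_theta_residual n r (U1 U2 : 'M[R]_(n, r)) : U1^T *m U1 = 1%:M ->
  sin_theta_F U1 U2 ^+ 2 = sqn ((1%:M - U1 *m U1^T) *m U2).
Proof.
move=> UU; rewrite sin_theta_sqr//; last exact: orthonormal_leq UU.
rewrite mulmxBl mul1mx -mulmxA sqnB (sqn_isometry _ UU).
rewrite mxdotC mxdot_mull -/(sqn _); ring.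
Qed.

End frobenius_inner_product.

(** * Projections onto graphs of sign matrices *)

Section graph_subspaces.
Variables (R : realType) (r m : nat).
Implicit Types (Y : 'M[R]_(m, r)) (U : 'M[R]_(r + m, r)).

Definition graph_mx Y : 'M[R]_(r + m, r) := col_mx 1%:M Y.

(** The second clause only places the columns of [U] in the graph; they span it, since
    orthonormality makes [T] invertible. *)
Definition graph_basis Y U : Prop :=
  U^T *m U = 1%:M /\ exists T : 'M[R]_r, U = graph_mx Y *m T.

Lemma exists_graph_basis Y : exists U, graph_basis Y U.
Proof.
have fG : row_free (graph_mx Y)^T.
  apply: inj_row_free => v /eqP; rewrite tr_col_mx mul_mx_row trmx1 mulmx1.
  by rewrite -[X in _ == X]row_mx0 => /eqP/eq_row_mx[].
have [T TG] := exists_orthonormalization fG.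
exists (graph_mx Y *m T^T); split; last by exists T^T.
by rewrite trmx_mul trmxK -[X in _ *m X]trmxK !trmx_mul !trmxK; move: TG; rewrite trmx_mul trmxK.
Qed.

Lemma sqn_graph n Y (A : 'M[R]_(r, n)) :
  sqn (graph_mx Y *m A) = sqn A + sqn (Y *m A).
Proof. by rewrite mul_col_mx mul1mx sqn_col_mx. Qed.

Lemma graph_basisE Y U : graph_basis Y U -> exists T : 'M[R]_r,
  [/\ U = graph_mx Y *m T, T \in unitmx & graph_mx Y = U *m invmx T].
Proof.
move=> [UU [T UE]]; have uT : T \in unitmx.
  by move: UU; rewrite {2}UE mulmxA => /mulmx1_unit[].
by exists T; split=> //; rewrite UE mulmxK.
Qed.

(** The residual projection kills [graph_mx Y], whose columns lie in the span of [U]; only the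
    difference of the two graphs survives. *)
Lemma graph_residual Y U Y' : graph_basis Y U ->
  (1%:M - U *m U^T) *m graph_mx Y' =
  (1%:M - U *m U^T) *m col_mx 0 (Y' - Y).
Proof.
move=> gU; have [T [_ _ GE]] := graph_basisE gU.
have -> : graph_mx Y' = graph_mx Y + col_mx 0 (Y' - Y).
  by rewrite add_col_mx addr0 addrC subrK.
rewrite mulmxDr {1}GE mulmxA [_ *m U]mulmxBl mul1mx -mulmxA gU.1 mulmx1.
by rewrite subrr mul0mx add0r.
Qed.

(** [U' = graph_mx Y' *m T'] with [T'] a contraction, because [|v|^2 = |U' v|^2 = |T' v|^2 + |Y' T'
    v|^2]; the residual projection is a contraction too. *)
Lemma sin_theta_graph_le Y U Y' U' : graph_basis Y U -> graph_basis Y' U' ->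
  sin_theta_F U U' ^+ 2 <= sqn (Y' - Y).
Proof.
move=> gU gU'; have [T' [U'E _ _]] := graph_basisE gU'.
have T'1 : opbound 1 T'.
  move=> v; rewrite mul1r -[leRHS](sqn_isometry v gU'.1) U'E -mulmxA sqn_graph.
  by rewrite lerDl sqn_ge0.
rewrite sin_theta_residual ?gU.1// U'E mulmxA (graph_residual _ gU) -mulmxA.
apply: (le_trans (sqn_proj_le _ _ _)).
- by rewrite linearB /= trmx1 trmx_mul trmxK.
- rewrite mulmxBr mulmx1 mulmxA [_ *m U]mulmxBl mul1mx -mulmxA gU.1 mulmx1.
  by rewrite subrr mul0mx subr0.
- apply: (le_trans (sqn_mulr_le _ ltr01 T'1)).
  by rewrite mul1r sqn_col_mx sqn0 add0r.
Qed.

(** The constant 4 is a product of two factors 2. One bounds the squared norm of [invmx T'], as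
    [|invmx T' v|^2 = |v|^2 + |Y' v|^2]; the other compares [Y' - Y] with its residual. *)
Lemma sin_theta_graph_ge Y U Y' U' : graph_basis Y U -> graph_basis Y' U' ->
  opbound 1 Y -> opbound 1 Y' ->
  sqn (Y' - Y) <= 4 * sin_theta_F U U' ^+ 2.
Proof.
move=> gU gU' Y1 Y'1; have [T [UE _ _]] := graph_basisE gU.
have [T' [U'E uT' G'E]] := graph_basisE gU'.
have T'2 : opbound 2 (invmx T').
  move=> v; rewrite -(sqn_isometry (invmx T' *m v) gU'.1) mulmxA -G'E sqn_graph.
  by have := Y'1 v; lra.
have := sqn_mulr_le ((1%:M - U *m U^T) *m U') (ltr0n R 2) T'2.
rewrite -mulmxA -G'E (graph_residual _ gU) -(sin_theta_residual U' gU.1).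
(* The residual of [col_mx 0 D] has blocks [- C] and [D - Y C]. As [|Y C| <= |C|], the two together
   control [D = (D - Y C) + Y C]. *)
set D := Y' - Y; pose C := T *m (U^T *m col_mx 0 D).
have -> : (1%:M - U *m U^T) *m col_mx 0 D = col_mx (- C) (D - Y *m C).
  rewrite mulmxBl mul1mx {1}UE -!mulmxA -/C mul_col_mx mul1mx.
  by rewrite opp_col_mx add_col_mx add0r.
rewrite sqn_col_mx sqnN.
have := sqnD_le (D - Y *m C) (Y *m C); rewrite subrK.
by have := sqn_mul_le C Y1; lra.
Qed.

Lemma sin_theta_triangle n (U1 U2 U3 : 'M[R]_(n, r)) :
  U1^T *m U1 = 1%:M -> U2^T *m U2 = 1%:M -> U3^T *m U3 = 1%:M ->
  sin_theta_F U2 U3 ^+ 2 <=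
  2 * (sin_theta_F U1 U2 ^+ 2 + sin_theta_F U1 U3 ^+ 2).
Proof.
move=> u1 u2 u3.
have halve (a b c x y z : R) :
    x = 2 * a -> y = 2 * b -> z = 2 * c -> x <= 2 * (y + z) -> a <= 2 * (b + c).
  by lra.
apply: (halve _ _ _ _ _ _ (sin_theta_proj_dist u2 u3)
  (sin_theta_proj_dist u1 u2) (sin_theta_proj_dist u1 u3)).
rewrite -(sqnN (U1 *m U1^T - U2 *m U2^T)) opprB.
by apply: le_trans (sqnD_le _ _); rewrite addrA subrK.
Qed.

End graph_subspaces.

(** * Random sign matrices are nearly orthogonal *)

Section sign_matrices.
Variables (R : realType) (m r : nat).
Local Notation cube := {ffun 'I_m * 'I_r -> bool}.
Implicit Types (t : cube) (k : 'I_m * 'I_r).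

Definition sign_mx t : 'M[R]_(m, r) := \matrix_(i, j) (-1) ^+ t (i, j).

Definition flip k t : cube := [ffun x => t x (+) (x == k)].

Lemma flipK k : involutive (flip k).
Proof. by move=> t; apply/ffunP => x; rewrite !ffunE -addbA addbb addbF. Qed.

Lemma sum_flip (V : nmodType) k (F : cube -> V) :
  \sum_t F (flip k t) = \sum_t F t.
Proof. by rewrite [RHS](reindex_inj (can_inj (flipK k))). Qed.

Lemma sqn_sign_mxB t t' :
  sqn (sign_mx t - sign_mx t') = 4 * \sum_k (t k != t' k)%:R.
Proof.
rewrite sqnE pair_big /= mulr_sumr; apply: eq_bigr => -[i j] _.
rewrite !mxE; case: (t _); case: (t' _); rewrite /= ?expr1 ?expr0; ring.
Qed.

Definition gram_defect t : 'M[R]_r := (sign_mx t)^T *m sign_mx t - m%:R%:M.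

(** The Frobenius norm of the defect dominates its operator norm, and its square is easily averaged
    over the cube. *)
Definition good t : bool := sqn (gram_defect t) <= m%:R ^+ 2.

(** [|W v|^2 = m |v|^2 + <v v^T, E>], and by Cauchy-Schwarz the last term is at most
    [|v|^2 |E| <= m |v|^2]. *)
Lemma opbound_sign_mx t : (0 < m)%N -> good t ->
  opbound (2 * m%:R) (sign_mx t).
Proof.
move=> m0 gt v; set W := sign_mx t; set E := gram_defect t.
have m0' : 0 < m%:R :> R by rewrite ltr0n.
have [v0|v0] := eqVneq (sqn v) 0.
  by rewrite (sqn_eq0 v0) mulmx0 !sqn0 mulr0.
have {}v0 : 0 < sqn v by rewrite lt0r v0 sqn_ge0.
have vv : sqn (v *m v^T) = sqn v ^+ 2.
  rewrite {1}/sqn mxdot_mull mulmxA.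
  have -> : v^T *m v = (sqn v)%:M by rewrite [LHS]mx11_scalar -trace_mx11.
  rewrite mul_scalar_mx /mxdot -scalemxAr mxtraceZ trmxK mxtrace_mulC.
  by rewrite -expr2.
have WE : sqn (W *m v) = m%:R * sqn v + mxdot (v *m v^T) E.
  rewrite {1}/sqn mxdot_mull mulmxA.
  have -> : W^T *m W = m%:R%:M + E by rewrite addrC subrK.
  rewrite mulmxDl mul_scalar_mx /mxdot mulmxDr mxtraceD -scalemxAr mxtraceZ.
  by congr (_ + _); rewrite trmx_mul trmxK -!mulmxA [RHS]mxtrace_mulC mulmxA.
(* Cauchy-Schwarz without square roots: the bound [|E|^2 <= m^2] is inserted in this expanded
   square. *)
have := sqn_ge0 (m%:R *: (v *m v^T) + (- sqn v) *: E).
rewrite sqn_lin vv WE; move: gt; rewrite /good -/E => gt h.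
have : 0 <= (2 * m%:R * sqn v) * (m%:R * sqn v - mxdot (v *m v^T) E).
  have : sqn v ^+ 2 * sqn E <= sqn v ^+ 2 * m%:R ^+ 2.
    by rewrite ler_pM2l// exprn_gt0.
  rewrite sqrrN in h; nra.
by rewrite pmulr_rge0 ?mulr_gt0//; lra.
Qed.

(** Diagonal entries of the defect vanish. An off-diagonal one is a sum of [m] uncorrelated signs,
    so its square averages to [m]. *)
Lemma sum_sqn_gram_defect :
  \sum_t sqn (gram_defect t) <= r%:R ^+ 2 * m%:R * #|{: cube}|%:R.
Proof.
pose s t i j : R := (-1) ^+ t (i, j).
have ss t i j : s t i j * s t i j = 1.
  by rewrite /s -expr2 sqrr_sign.
have EE t j j' : gram_defect t j j' = (\sum_i s t i j * s t i j') - (m%:R *+ (j == j')).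
  by rewrite !mxE; congr (_ - _); apply: eq_bigr => i _; rewrite !mxE.
under eq_bigr do rewrite sqnE.
rewrite exchange_big /=; under eq_bigr do rewrite exchange_big /=.
have -> : r%:R ^+ 2 * m%:R * #|{: cube}|%:R =
    \sum_(j < r) \sum_(j' < r) (m%:R * #|{: cube}|%:R) :> R.
  move: (#|{: cube}|%:R : R) => N.
  by rewrite sumr_const sumr_const card_ord -mulrnA -[RHS]mulr_natr natrM; ring.
apply: ler_sum => j _; apply: ler_sum => j' _.
have [<-|jj'] := eqVneq j j'.
  rewrite big1 ?mulr_ge0// => t _; rewrite EE eqxx.
  by rewrite (eq_bigr (fun=> 1)) ?sumr_const ?card_ord ?subrr ?expr0n// => i _.
have -> : \sum_t gram_defect t j j' ^+ 2 =
    \sum_i \sum_i' \sum_t (s t i j * s t i j' * (s t i' j * s t i' j')).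
  rewrite exchange_big /=; under [RHS]eq_bigr do rewrite exchange_big /=.
  rewrite [RHS]exchange_big /=; apply: eq_bigr => t _.
  rewrite EE (negbTE jj') subr0 expr2 mulr_suml exchange_big/=.
  by apply: eq_bigr => i _; rewrite mulr_sumr.
have -> : m%:R * #|{: cube}|%:R = \sum_(i < m) #|{: cube}|%:R :> R.
  by rewrite sumr_const card_ord mulr_natl.
apply: ler_sum => i _; rewrite (bigD1 i)//= [X in _ + X]big1 ?addr0.
  rewrite (eq_bigr (fun=> 1)) ?sumr_const// => t _.
  by rewrite mulrACA !ss mulr1.
(* Cross terms of distinct rows cancel: flipping the sign at [(i, j)] permutes the cube and negates
   the summand. *)
move=> i' i'i; apply/eqP; rewrite -eqNr -sumrN -[X in _ == X](sum_flip (i, j)).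
apply/eqP; apply: eq_bigr => t _.
rewrite /s !ffunE !xpair_eqE !eqxx (negbTE i'i) /= (eq_sym j') (negbTE jj').
by rewrite !addbF addbT signrN !mulNr.
Qed.

(** Markov's inequality at the threshold [m ^ 2]: the proportion of bad sign matrices is at most
    [r ^ 2 / m <= 1 / 4]. *)
Lemma card_good : (0 < m)%N -> (4 * r ^ 2 <= m)%N ->
  4 * \sum_t (~~ good t)%:R <= #|{: cube}|%:R :> R.
Proof.
move=> m0 rm; have m0' : 0 < m%:R :> R by rewrite ltr0n.
have h : m%:R ^+ 2 * (\sum_t (~~ good t)%:R) <= r%:R ^+ 2 * m%:R * #|{: cube}|%:R :> R.
  apply: le_trans sum_sqn_gram_defect; rewrite mulr_sumr; apply: ler_sum => t _.
  case: (boolP (good t)) => [_|]; first by rewrite mulr0 sqn_ge0.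
  by rewrite /good -ltNge mulr1 => /ltW.
have rm' : 4 * r%:R ^+ 2 <= m%:R :> R by rewrite -natrX -natrM ler_nat.
move: (#|{: cube}|%:R : R) (ler0n R #|{: cube}|) h => N N0 h.
rewrite -(ler_pM2l (exprn_gt0 2 m0')).
have h2 : 4 * r%:R ^+ 2 * (m%:R * N) <= m%:R * (m%:R * N) :> R.
  by rewrite ler_wpM2r// mulr_ge0.
nra.
Qed.

End sign_matrices.

Local Open Scope classical_set_scope.
Local Open Scope ring_scope.

(** * Assouad's lemma *)

Section assouad.
Context d (T : measurableType d) (R : realType) (P : probability T R).
Variables (m r : nat).
Local Notation cube := {ffun 'I_m * 'I_r -> bool}.
Implicit Types (t : cube) (k : 'I_m * 'I_r).
(** [Z t] is the likelihood at the vertex [t], and [that] the vertex decoded from the data. The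
    density [M k t] scaled by [q] lies below the geometric mean of the likelihoods at the two ends
    of an edge, so [q] bounds their Hellinger affinity from below. *)
Variables (G : pred cube) (Z : cube -> T -> R) (M : 'I_m * 'I_r -> cube -> T -> R).
Variables (loss : cube -> T -> R) (that : T -> cube) (a q : R).
Hypotheses (a0 : 0 <= a) (q0 : 0 <= q).
Hypotheses (mZ : forall t, measurable_fun setT (Z t)) (Z0 : forall t w, 0 <= Z t w).
Hypothesis intZ : forall t, (\int[P]_w (Z t w)%:E = 1)%E.
Hypotheses (mM : forall k t, measurable_fun setT (M k t)) (M0 : forall k t w, 0 <= M k t w).
Hypothesis intM : forall k t, (\int[P]_w (M k t w)%:E = 1)%E.
Hypothesis qM : forall k t w, (q * M k t w) ^+ 2 <= Z t w * Z (flip k t) w.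
Hypotheses (mloss : forall t, measurable_fun setT (loss t)) (loss0 : forall t w, 0 <= loss t w).
Hypothesis loss_ge : forall t w, G t -> a * \sum_k (that w k != t k)%:R <= loss t w.

Definition good_edge k t : bool := G t && G (flip k t).

(** Two-point testing bound along the direction [k]. The factor 2 arises because a good vertex may
    occur both as [t] and as [flip k t]. *)
Lemma hamming_edge k w :
  \sum_(t | good_edge k t) (q * M k t w - (Z t w + Z (flip k t) w) / 4) <=
  2 * \sum_(t | G t) (that w k != t k)%:R * Z t w.
Proof.
pose h t := (that w k != t k)%:R * Z t w.
have h0 t : 0 <= h t by rewrite mulr_ge0.
apply: (@le_trans _ _ (\sum_(t | good_edge k t) (h t + h (flip k t)))).
  apply: ler_sum => t _; rewrite /h !ffunE eqxx.
  have := qM k t w; have := Z0 t w; have := Z0 (flip k t) w; have := M0 k t w.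
  move: (M k t w) (Z t w) (Z (flip k t) w) => g x y g0 y0 x0 gxy.
  have gq0 : 0 <= q * g by rewrite mulr_ge0.
  (* If the estimated k-th sign is wrong at t it is right at [flip k t], and
     conversely, so either likelihood must dominate the summand on the left. *)
  have bound u v : 0 <= u -> 0 <= v -> (q * g) ^+ 2 <= u * v -> q * g - (u + v) / 4 <= u.
    move=> u0 v0 guv; suff : q * g <= (5 * u + v) / 4 by lra.
    rewrite -ler_sqr ?nnegrE//; last lra.
    (* The gap is a sum of squares: [(5 u + v)^2 - 16 u v = (4 u)^2 + (3 u - v)^2]. *)
    by apply: (le_trans guv); have := sqr_ge0 (3 * u - v); nra.
  have bx := bound x y x0 y0 gxy.
  have by_ : q * g - (x + y) / 4 <= y.
    by rewrite (addrC x); apply: bound => //; rewrite (mulrC y).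
  by case: (that w k); case: (t k); rewrite /=; lra.
rewrite big_split /= mulr2n mulrDl mul1r lerD//.
  rewrite big_mkcond [leRHS]big_mkcond; apply: ler_sum => t _.
  by rewrite /good_edge; case: (G t); case: (G (flip k t)) => //=; exact: h0.
rewrite big_mkcond -(sum_flip k) [leRHS]big_mkcond; apply: ler_sum => t _.
by rewrite /good_edge flipK; case: (G t); case: (G (flip k t)) => //=; exact: h0.
Qed.

(** The negative term of the edge bound is moved to the right, so that only nonnegative functions
    have to be integrated. *)
Lemma assouad_pointwise w :
  a / 2 * (\sum_k \sum_(t | good_edge k t) q * M k t w) <=
  \sum_(t | G t) loss t w * Z t w +
  a / 8 * \sum_k \sum_(t | good_edge k t) (Z t w + Z (flip k t) w).
Proof.
have h : \sum_k \sum_(t | good_edge k t) q * M k t w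
   - 4^-1 * \sum_k \sum_(t | good_edge k t) (Z t w + Z (flip k t) w) <=
   2 * \sum_k \sum_(t | G t) (that w k != t k)%:R * Z t w.
  rewrite !mulr_sumr -sumrB; apply: ler_sum => k _.
  apply: le_trans (hamming_edge k w); rewrite mulr_sumr -sumrB.
  by apply: ler_sum => t _; rewrite [X in _ - X <= _]mulrC.
have h' : a * \sum_k \sum_(t | G t) (that w k != t k)%:R * Z t w <=
    \sum_(t | G t) loss t w * Z t w.
  rewrite exchange_big mulr_sumr; apply: ler_sum => t Gt.
  by rewrite -mulr_suml mulrA ler_wpM2r// loss_ge.
have := ler_wpM2l a0 h; lra.
Qed.

(** Integrate the pointwise bound: per good edge, [q * M k t] contributes [q] and the two
    likelihoods contribute 2, which leaves [a / 2 * q - a / 8 * 2]. *)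
Lemma assouad :
  ((a * (q / 2 - 4^-1) * \sum_k \sum_(t | good_edge k t) 1)%:E <=
   \sum_(t | G t) \int[P]_w (loss t w * Z t w)%:E)%E.
Proof.
pose n : R := \sum_k \sum_(t | good_edge k t) 1.
have mlZ t : measurable_fun setT (fun w => loss t w * Z t w) by exact: measurable_funM.
have lZ0 t w : 0 <= loss t w * Z t w by rewrite mulr_ge0.
have mL : measurable_fun setT (fun w => \sum_(t | G t) loss t w * Z t w).
  by under eq_fun do rewrite -big_filter; exact: measurable_sum.
have mDS (F : 'I_m * 'I_r -> cube -> T -> R) : (forall k t, measurable_fun setT (F k t)) ->
    measurable_fun setT (fun w => \sum_k \sum_(t | good_edge k t) F k t w).
  move=> mF; apply: measurable_sum => k.
  by under eq_fun do rewrite -big_filter; exact: measurable_sum.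
have iDS (F : 'I_m * 'I_r -> cube -> T -> R) (c e : R) : 0 <= c ->
    (forall k t, measurable_fun setT (F k t)) -> (forall k t w, 0 <= F k t w) ->
    (forall k t, \int[P]_w (F k t w)%:E = e%:E)%E ->
    (\int[P]_w (c * \sum_k \sum_(t | good_edge k t) F k t w)%:E = (c * (e * n))%:E)%E.
  move=> c0 mF F0 Fe; under eq_integral do rewrite EFinM.
  rewrite ge0_integralZl//; last 2 first.
  - by apply/measurable_EFinP; exact: mDS.
  - by move=> w _; rewrite lee_fin; do 2 (apply: sumr_ge0 => ? _).
  rewrite EFinM; congr (_ * _)%E.
  under eq_integral do rewrite -sumEFin.
  rewrite ge0_integral_sum//; last 2 first.
  - move=> k; apply/measurable_EFinP.
    by under eq_fun do rewrite -big_filter; exact: measurable_sum.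
  - by move=> k w _; rewrite lee_fin; apply: sumr_ge0.
  rewrite /n mulr_sumr -sumEFin; apply: eq_bigr => k _.
  under eq_integral do rewrite -big_filter -sumEFin.
  rewrite ge0_integral_sum//; last 2 first.
  - by move=> t; exact/measurable_EFinP.
  - by move=> t w _; rewrite lee_fin.
  rewrite big_filter mulr_sumr -sumEFin; apply: eq_bigr => t _.
  by rewrite Fe mulr1.
have -> : (\sum_(t | G t) \int[P]_w (loss t w * Z t w)%:E =
    \int[P]_w (\sum_(t | G t) loss t w * Z t w)%:E)%E.
  under [RHS]eq_integral do rewrite -big_filter -sumEFin.
  rewrite ge0_integral_sum//; last 2 first.
  - by move=> t; exact/measurable_EFinP.
  - by move=> t w _; rewrite lee_fin.
  by rewrite big_filter.
pose Zs k t w := Z t w + Z (flip k t) w.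
have mZs k t : measurable_fun setT (Zs k t) by exact: measurable_funD.
have Zs0 k t w : 0 <= Zs k t w by rewrite addr_ge0.
have intZs k t : (\int[P]_w (Zs k t w)%:E = 2%:E)%E.
  under eq_integral do rewrite EFinD.
  rewrite ge0_integralD//; last 4 first.
  - by move=> w _; rewrite lee_fin.
  - exact/measurable_EFinP.
  - by move=> w _; rewrite lee_fin.
  - exact/measurable_EFinP.
  by rewrite !intZ.
have a8 : 0 <= a / 8 by rewrite divr_ge0.
have a2 : 0 <= a / 2 by rewrite divr_ge0.
pose qM' k t w := q * M k t w.
have iqM k t : (\int[P]_w (qM' k t w)%:E = q%:E)%E.
  under eq_integral do rewrite EFinM.
  rewrite ge0_integralZl//; last 2 first.
  - exact/measurable_EFinP.
  - by move=> w _; rewrite lee_fin.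
  by rewrite intM mule1.
have mqM k t : measurable_fun setT (qM' k t) by exact: measurable_funM.
have qM0 k t w : 0 <= qM' k t w by rewrite mulr_ge0.
have lhs := iDS qM' _ _ a2 mqM qM0 iqM.
have rhs := iDS Zs _ _ a8 mZs Zs0 intZs.
have L0 w : 0 <= \sum_(t | G t) loss t w * Z t w by apply: sumr_ge0.
have S0 w : 0 <= a / 8 * \sum_k \sum_(t | good_edge k t) Zs k t w.
  by rewrite mulr_ge0//; do 2 (apply: sumr_ge0 => ? _).
have : ((a / 2 * (q * n))%:E <= \int[P]_w (\sum_(t | G t) loss t w * Z t w)%:E
   + (a / 8 * (2 * n))%:E)%E.
  rewrite -lhs -rhs -ge0_integralD//; last 4 first.
  - by move=> w _; rewrite lee_fin.
  - exact/measurable_EFinP.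
  - by move=> w _; rewrite lee_fin.
  - by apply/measurable_EFinP/measurable_funM => //; exact: mDS.
  apply: ge0_le_integral => //.
  - move=> w _; rewrite lee_fin mulr_ge0//.
    by do 2 (apply: sumr_ge0 => ? _).
  - by apply/measurable_EFinP/measurable_funM => //; exact: mDS.
  - apply: emeasurable_funD; first exact/measurable_EFinP.
    by apply/measurable_EFinP/measurable_funM => //; exact: mDS.
  - by move=> w _; rewrite -EFinD lee_fin; exact: assouad_pointwise.
rewrite -leeBlDr// -EFinB -/n; apply: le_trans; rewrite lee_fin; lra.
Qed.

End assouad.

(** * Counting the edges between good vertices *)

Section good_edges.
Variables (R : realType) (m r : nat).
Local Notation cube := {ffun 'I_m * 'I_r -> bool}.

(** Union bound: at most a quarter of the vertices are bad, so in each direction at least half of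
    the [t] have both [t] and [flip k t] good. *)
Lemma sum_good_edge_ge : (0 < m)%N -> (4 * r ^ 2 <= m)%N ->
  m%:R * r%:R / 2 * #|{: cube}|%:R <=
  \sum_(k : 'I_m * 'I_r) \sum_(t | good_edge (@good R m r) k t) 1 :> R.
Proof.
move=> m0 rm; pose N : R := #|{: cube}|%:R.
have -> : m%:R * r%:R / 2 * N = \sum_(k : 'I_m * 'I_r) (N / 2).
  rewrite sumr_const card_prod !card_ord -[RHS]mulr_natr natrM.
  by move: (N) => N'; field.
apply: ler_sum => k _; have := @card_good R m r m0 rm; rewrite -/N.
set b := \sum_t _ => b4.
have bE : b = \sum_t (~~ good R (flip k t))%:R by rewrite (sum_flip k (fun t => (~~ good R t)%:R)).
have NE : N = \sum_(t : cube) 1 by rewrite sumr_const.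
suff : N - (b + b) <= \sum_(t | good_edge (@good R m r) k t) 1 by lra.
rewrite NE {2}bE -big_split -sumrB /= [leRHS]big_mkcond; apply: ler_sum => t _.
by rewrite /good_edge; case: (good R t); case: (good R (flip k t)) => /=; lra.
Qed.

End good_edges.

(** * Gaussian change of measure *)

Section weighted_image.
Context d1 d2 (T : measurableType d1) (E : measurableType d2) (R : realType).
Variable mu : {measure set T -> \bar R}.

(** The image under [phi] of the measure with density [Z] with respect to [mu]. *)
Definition weighted_image (phi : T -> E) (Z : T -> R) (B : set E) : \bar R :=
  (\int[mu]_(w in phi @^-1` B) (Z w)%:E)%E.

Variables (phi : T -> E) (Z : T -> R).
Hypotheses (mphi : measurable_fun setT phi) (mZ : measurable_fun setT Z).
Hypothesis Z0 : forall w, 0 <= Z w.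

Let mpre B : measurable B -> measurable (phi @^-1` B).
Proof. by move=> mB; rewrite -[X in measurable X]setTI; exact: mphi. Qed.

Let wi0 : weighted_image phi Z set0 = 0%E.
Proof. by rewrite /weighted_image preimage_set0 integral_set0. Qed.

Let wi_ge0 B : (0 <= weighted_image phi Z B)%E.
Proof. by apply: integral_ge0 => w _; rewrite lee_fin. Qed.

Let wi_sigma_additive : semi_sigma_additive (weighted_image phi Z).
Proof.
move=> F mF tF mUF; rewrite /weighted_image preimage_bigcup ge0_integral_bigcup//.
- by apply: is_cvg_ereal_nneg_natsum_cond => n _ _; exact: wi_ge0.
- by move=> k; exact: mpre.
- by apply/measurable_EFinP; exact: measurable_funTS.
- by move=> w _; rewrite lee_fin.
- apply/trivIsetP => i j _ _ ij.
  by rewrite -preimage_setI (trivIsetP.1 tF i j)// preimage_set0.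
Qed.

Let wi_measure : {measure set E -> \bar R} :=
  HB.pack (weighted_image phi Z)
    (isMeasure.Build _ _ _ (weighted_image phi Z) wi0 wi_ge0 wi_sigma_additive).

Lemma weighted_image_measure :
  exists nu : {measure set E -> \bar R}, nu = weighted_image phi Z :> (set E -> \bar R).
Proof. by exists wi_measure. Qed.

Import HBNNSimple.

(** For indicators this is the definition of [weighted_image]; linearity gives simple functions, and
    monotone convergence the rest. *)
Lemma integral_weighted_image (nu : {measure set E -> \bar R}) (f : E -> R) :
  nu = weighted_image phi Z :> (set E -> \bar R) ->
  measurable_fun setT f -> (forall x, 0 <= f x) ->
  (\int[nu]_x (f x)%:E = \int[mu]_w (f (phi w) * Z w)%:E)%E.
Proof.
move=> nuE mf f0.
have mEf : measurable_fun setT (EFin \o f) by exact/measurable_EFinP.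
pose f_ := nnsfun_approx measurableT mEf.
have f_0 n x : 0 <= f_ n x by [].
have mf_phi n : measurable_fun setT (fun w => f_ n (phi w)).
  by apply: measurableT_comp => //; exact: measurable_funP.
transitivity (limn (fun n => \int[nu]_x (f_ n x)%:E))%E.
  rewrite -monotone_convergence//.
  - apply: eq_integral => y _; apply/esym/cvg_lim => //.
    by apply: cvg_nnsfun_approx=> // x _; rewrite /= lee_fin.
  - by move=> n; exact/measurable_EFinP/measurable_funP.
  - by move=> n y _; rewrite lee_fin.
  - by move=> y _ m n mn; rewrite lee_fin; exact/lefP/nd_nnsfun_approx.
rewrite [X in limn X](_ : _ =
    (fun n => \int[mu]_w ((Z w)%:E * (f_ n (phi w))%:E))%E).
  rewrite -monotone_convergence//; last 3 first.
    - by move=> n; apply/measurable_EFinP/measurable_funM.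
    - by move=> n x _ /=; rewrite mule_ge0// lee_fin.
    - move=> x _ m n mn /=; rewrite lee_wpmul2l// ?lee_fin//.
      exact/lefP/nd_nnsfun_approx.
  apply: eq_integral => x _ /=; apply/cvg_lim => //.
  rewrite EFinM muleC; apply: cvgeZl => //.
  by apply: (@cvg_nnsfun_approx _ _ _ _ _ _ mEf) => // y _; rewrite /= lee_fin.
apply/funext => n.
have mk r : measurable (f_ n @^-1` [set r]).
  by rewrite -[X in measurable X]setTI; apply: measurable_funP.
transitivity (\sum_(k \in range (f_ n))
    \int[mu]_w ((Z w)%:E * (k * \1_(f_ n @^-1` [set k]) (phi w))%:E))%E.
  under eq_integral do rewrite fimfunE -fsumEFin//.
  rewrite ge0_integral_fsum//; last 2 first.
  - by move=> y; exact/measurable_EFinP/measurable_funM.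
  - by move=> y x _; rewrite nnfun_muleindic_ge0.
  apply: eq_fsbigr => r; rewrite inE => -[x _ xr].
  have r0 : 0 <= r by rewrite -xr.
  rewrite integralZl_indic_nnsfun// integral_indic//= setIT nuE.
  rewrite /weighted_image integral_mkcond epatch_indic.
  rewrite -ge0_integralZl//; last 2 first.
  - by apply/measurable_EFinP/measurable_funM => //; apply: measurable_indic; exact: mpre.
  - by move=> w _; rewrite mule_ge0// lee_fin.
  by apply: eq_integral => w _; rewrite muleCA EFinM.
rewrite -ge0_integral_fsum//.
- apply: eq_integral => w _; rewrite -ge0_mule_fsumr.
    by rewrite fsumEFin// -fimfunE.
  by move=> k; rewrite nnfun_muleindic_ge0.
- move=> r; apply/measurable_EFinP/measurable_funM => //; apply: measurable_funM => //.
  by apply: (@measurableT_comp _ _ _ _ _ _ (\1_(f_ n @^-1` [set r]) : E -> R)).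
- by move=> r x _; rewrite mule_ge0 ?lee_fin// -lee_fin nnfun_muleindic_ge0.
Qed.

End weighted_image.

Section integral_transfer.
Context d1 d2 (T : measurableType d1) (E : measurableType d2) (R : realType).
Variable mu : {measure set T -> \bar R}.
Variables (phi psi : T -> E) (Z W : T -> R).
Hypotheses (mphi : measurable_fun setT phi) (mpsi : measurable_fun setT psi).
Hypotheses (mZ : measurable_fun setT Z) (mW : measurable_fun setT W).
Hypotheses (Z0 : forall w, 0 <= Z w) (W0 : forall w, 0 <= W w).

Lemma integral_transfer (f : E -> R) :
  (forall B, measurable B -> weighted_image mu phi Z B = weighted_image mu psi W B) ->
  measurable_fun setT f -> (forall x, 0 <= f x) ->
  (\int[mu]_w (f (phi w) * Z w)%:E = \int[mu]_w (f (psi w) * W w)%:E)%E.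
Proof.
move=> ZW mf f0.
have [nu1 e1] := weighted_image_measure mu mphi mZ Z0.
have [nu2 e2] := weighted_image_measure mu mpsi mW W0.
rewrite -(integral_weighted_image mphi mZ Z0 e1)//.
rewrite -(integral_weighted_image mpsi mW W0 e2)//.
by apply: eq_measure_integral => B mB _; rewrite e1 e2 ZW.
Qed.

(** Uniqueness of finite measures that agree on a generating pi-system. *)
Lemma weighted_image_unique (G : set (set E)) :
  @measurable _ E = <<s G >> -> setI_closed G -> G setT ->
  weighted_image mu phi Z setT \is a fin_num ->
  (forall B, G B -> weighted_image mu phi Z B = weighted_image mu psi W B) ->
  forall B, measurable B -> weighted_image mu phi Z B = weighted_image mu psi W B.
Proof.
move=> mG IG GT finZ ZW B mB.
have [nu1 e1] := weighted_image_measure mu mphi mZ Z0.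
have [nu2 e2] := weighted_image_measure mu mpsi mW W0.
rewrite -e1 -e2; apply: (measure_unique G (fun=> setT)) => //.
- by rewrite bigcup_const.
- by move=> A GA; rewrite e1 e2 ZW.
- by move=> k; rewrite e1 ltey_eq finZ.
Qed.

End integral_transfer.

(** * Expectation of a product of functions of independent variables *)

Lemma indic_bigcap (T : Type) (R : realType) (I : finType) (A : I -> set T) (w : T) :
  \1_(\bigcap_i A i) w = \prod_i \1_(A i) w :> R.
Proof.
have [wA|wA] := pselect ((\bigcap_i A i) w).
  rewrite indicE mem_set// big1// => i _; rewrite indicE mem_set//.
  exact: wA.
rewrite indicE memNset//; apply/esym/eqP; rewrite prodf_seq_eq0; apply/hasP.
have [i wi] : exists i, ~ A i w.
  by apply/existsNP => h; apply: wA => i _; exact: h.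
by exists i; [exact: mem_index_enum|rewrite /= indicE memNset].
Qed.

Section product_expectation.
Context d (T : measurableType d) (R : realType) (P : probability T R).
Variables (I : finType) (X : I -> T -> R).
Hypothesis mX : forall i, measurable_fun setT (X i).
Hypothesis indepX : forall B : I -> set R, (forall i, measurable (B i)) ->
  P (\bigcap_i (X i @^-1` B i)) = (\prod_i P (X i @^-1` B i))%E.

Let mpre i B : measurable B -> measurable (X i @^-1` B).
Proof. by move=> mB; rewrite -[X in measurable X]setTI; exact: mX. Qed.

Lemma integral_indic_comp i B : measurable B ->
  (\int[P]_w (\1_B (X i w))%:E = P (X i @^-1` B))%E.
Proof.
move=> mB; rewrite -[X in _ = P X]setIT -integral_indic//; last exact: mpre.
Qed.

Lemma expectation_prod (F : I -> R -> R) (e : I -> R) :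
  (forall i, measurable_fun setT (F i)) -> (forall i x, 0 <= F i x) ->
  (forall i, \int[P]_w (F i (X i w))%:E = (e i)%:E)%E ->
  (\int[P]_w (\prod_i F i (X i w))%:E = (\prod_i e i)%:E)%E.
Proof.
(* Independence is the case of indicators; they are replaced by arbitrary
   functions one coordinate at a time, s listing the coordinates already done. *)
suff gen (s : seq I) : forall (F : I -> R -> R) (e : I -> R),
    (forall i, i \notin s -> exists2 B, measurable B & F i = \1_B) ->
    (forall i, measurable_fun setT (F i)) -> (forall i x, 0 <= F i x) ->
    (forall i, \int[P]_w (F i (X i w))%:E = (e i)%:E)%E ->
    (\int[P]_w (\prod_i F i (X i w))%:E = (\prod_i e i)%:E)%E.
  by apply: (gen (enum I)) => i; rewrite mem_enum.
elim: s => [|k s IH] {}F {}e Findic mF F0 Fe.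
  have /choice[B BP] : forall i, exists B, measurable B /\ F i = \1_B.
    by move=> i; have [//|B mB FB] := Findic i; exists B.
  have PB i : P (X i @^-1` B i) = (e i)%:E.
    rewrite -Fe -integral_indic_comp; last exact: (BP i).1.
    by apply: eq_integral => w _; rewrite (BP i).2.
  transitivity (P (\bigcap_i (X i @^-1` B i))); last first.
    rewrite indepX; last by move=> i; exact: (BP i).1.
    by rewrite (eq_bigr _ (fun i _ => PB i)) prodEFin.
  rewrite -[X in _ = P X]setIT -integral_indic//; last first.
    by apply: fin_bigcap_measurable => // i _; apply: mpre; exact: (BP i).1.
  apply: eq_integral => w _; congr EFin; rewrite indic_bigcap.
  by apply: eq_bigr => i _; rewrite (BP i).2.
pose Z w := \prod_(i | i != k) F i (X i w).
pose c := \prod_(i | i != k) e i.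
have e0 i : 0 <= e i.
  by rewrite -lee_fin -Fe; apply: integral_ge0 => w _; rewrite lee_fin.
have mZ : measurable_fun setT Z.
  rewrite /Z; under eq_fun do rewrite -big_filter.
  apply: measurable_prod => i _.
  by apply: (measurableT_comp (mF i)); exact: mX.
have Z0 w : 0 <= Z w by apply: prodr_ge0.
have c0 : 0 <= c by apply: prodr_ge0.
have splitF w : \prod_i F i (X i w) = F k (X k w) * Z w by rewrite (bigD1 k).
under eq_integral do rewrite splitF.
(* The weight [Z] may be replaced by its mean [c]: both give the same image under [X k], by the
   induction hypothesis with an indicator in place of [F k]. *)
rewrite (@integral_transfer _ _ _ _ _ P (X k) (X k) Z (cst c))//.
- rewrite (bigD1 k)//= -/c EFinM -Fe -ge0_integralZr//.
  + by apply/measurable_EFinP; apply: (measurableT_comp (mF k)); exact: mX.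
  + by move=> w _; rewrite lee_fin.
- move=> B mB; rewrite /weighted_image integral_mkcond epatch_indic.
  have mXB := mpre k mB.
  pose F' i := if i == k then \1_B : R -> R else F i.
  pose e' i := if i == k then fine (P (X k @^-1` B)) else e i.
  have := IH F' e'.
  have -> : \prod_i e' i = fine (P (X k @^-1` B)) * c.
    rewrite (bigD1 k)//= {1}/e' eqxx; congr (_ * _).
    by apply: eq_bigr => i ik; rewrite /e' (negbTE ik).
  move=> IH'; have -> : (\int[P]_(w in X k @^-1` B) (cst c w)%:E =
      c%:E * P (X k @^-1` B))%E by rewrite -(integral_cst P mXB c%:E).
  rewrite -[X in _ = (_ * X)%E]fineK//; last exact: fin_num_measure.
  rewrite muleC -EFinM -IH'.
  + apply: eq_integral => w _; rewrite -EFinM; congr EFin.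
    rewrite (bigD1 k)//= {1}/F' eqxx mulrC; congr (_ * _).
    by apply: eq_bigr => i ik; rewrite /F' (negbTE ik).
  + move=> i; rewrite /F'; have [_ _|ik is_] := eqVneq i k; first by exists B.
    by apply: Findic; rewrite inE negb_or ik.
  + by move=> i; rewrite /F'; case: ifP => // _; exact: measurable_indic.
  + by move=> i x; rewrite /F'; case: ifP.
  + move=> i; rewrite /F' /e'; have [->|_] := eqVneq i k; last exact: Fe.
    by rewrite integral_indic_comp// fineK// fin_num_measure.
Qed.

End product_expectation.

(** * Shifting one Gaussian variable *)

Section gaussian_shift.
Context (R : realType).
Local Notation mu := (@lebesgue_measure R).

(** Translation invariance need only be checked on half-open intervals, which determine Lebesgue
    measure. *)
Lemma ge0_integral_translation (f : R -> R) (s : R) :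
  measurable_fun setT f -> (forall x, 0 <= f x) ->
  (\int[mu]_x (f (x + s)%R)%:E = \int[mu]_x (f x)%:E)%E.
Proof.
move=> mf f0.
have mt : measurable_fun setT (fun x : measurableTypeR R => x + s : measurableTypeR R).
  exact: measurable_funD.
rewrite -(@ge0_integral_pushforward _ _ _ _ _ _ mt mu setT (fun x => (f x)%:E))//.
- apply: eq_measure_integral => A mA _; apply/esym/lebesgue_measure_unique => //.
  move=> _ [[a b]] _ <-.
  suff : mu [set` `]a, b]] = mu ((fun x : R => x + s) @^-1` [set` `]a, b]]) by [].
  have -> : (fun x : R => x + s) @^-1` [set` `]a, b]] = [set` `](a - s), (b - s)]].
    by apply/seteqP; split=> x /=; rewrite !in_itv /= ltrBlDr lerBrDr.
  rewrite !lebesgue_measure_itv /= !lte_fin ltrD2r -!EFinB.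
  by rewrite opprB addrA subrK.
- exact/measurable_EFinP.
- by move=> x _; rewrite lee_fin.
Qed.

Context d (T : measurableType d) (P : probability T R) (X : T -> R) (v : R).
Hypotheses (v0 : 0 < v) (gX : centered_gaussian P v X).

(** The density of the normal law of mean [s] and variance [v] relative to the centered one. *)
Definition tilt (v s x : R) : R := expR (s * x / v - s ^+ 2 / (2 * v)).

Lemma measurable_tilt s : measurable_fun setT (tilt v s).
Proof.
apply: measurableT_comp => //; apply: measurable_funB => //.
by apply: measurable_funM => //; exact: measurable_funM.
Qed.

Lemma normal_pdf_tilt s x :
  normal_pdf 0 (Num.sqrt v) (x - s) = tilt v s x * normal_pdf 0 (Num.sqrt v) x.
Proof.
have sv : Num.sqrt v != 0 by rewrite sqrtr_eq0 -ltNge.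
rewrite normal_pdfE//= mulrCA; congr (_ * _).
rewrite /normal_fun /tilt -expRD !subr0 sqr_sqrtr ?ltW//; congr expR.
by field; rewrite gt_eqF.
Qed.

Lemma integral_gaussian (f : R -> R) :
  measurable_fun setT f -> (forall x, 0 <= f x) ->
  (\int[P]_w (f (X w))%:E =
   \int[mu]_x (f x * normal_pdf 0 (Num.sqrt v) x)%:E)%E.
Proof.
move=> mf f0; case: gX => mX XP.
transitivity (\int[normal_prob 0 (Num.sqrt v)]_x (f x)%:E)%E; last first.
  exact: (@integral_weighted_image _ _ (measurableTypeR R) (measurableTypeR R) R mu
    idfun _ (@measurable_id _ _ setT) (measurable_normal_pdf 0 (Num.sqrt v))
    (normal_pdf_ge0 0 (Num.sqrt v)) (normal_prob 0 (Num.sqrt v)) f erefl mf f0).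
have mX' : measurable_fun setT (X : T -> measurableTypeR R) by [].
transitivity (\int[pushforward P (X : T -> measurableTypeR R)]_x (f x)%:E)%E.
  rewrite (@ge0_integral_pushforward _ _ _ _ _ _ mX' P setT (fun x => (f x)%:E))//.
  - exact/measurable_EFinP.
  - by move=> x _; rewrite lee_fin.
by apply: eq_measure_integral => A mA _; exact: XP.
Qed.

(** Both sides become Lebesgue integrals; the translation by [s] carries the tilted density back to
    the centered one. *)
Lemma gaussian_shift s B : measurable B ->
  (\int[P]_w (\1_B (X w) * tilt v s (X w))%:E = P ((fun w => X w + s)%R @^-1` B))%E.
Proof.
move=> mB; case: (gX) => mX XP.
have mIB : measurable_fun setT (\1_B : R -> R) by exact: measurable_indic.
have mXs : measurable_fun setT (fun w => X w + s) by exact: measurable_funD.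
have mXsB : measurable ((fun w => X w + s) @^-1` B).
  by rewrite -[X in measurable X]setTI; exact: mXs.
rewrite (@integral_gaussian (fun x => \1_B x * tilt v s x)); last 2 first.
- by apply: measurable_funM => //; exact: measurable_tilt.
- by move=> x; rewrite mulr_ge0// expR_ge0.
rewrite -(@ge0_integral_translation _ s); last 2 first.
- apply: measurable_funM; last exact: measurable_normal_pdf.
  by apply: measurable_funM => //; exact: measurable_tilt.
- by move=> x; rewrite mulr_ge0// ?normal_pdf_ge0// mulr_ge0// expR_ge0.
rewrite -[X in _ = P X]setIT -integral_indic//.
rewrite (@integral_gaussian (fun x => \1_B (x + s))); last 2 first.
- by apply: (measurableT_comp mIB); exact: measurable_funD.
- by [].
apply: eq_integral => x _; rewrite -mulrA -normal_pdf_tilt addrK//.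
Qed.

Lemma integral_tilt s : (\int[P]_w (tilt v s (X w))%:E = 1)%E.
Proof.
have := gaussian_shift s measurableT; rewrite preimage_setT probability_setT => <-.
by apply: eq_integral => w _; rewrite indicT mul1r.
Qed.

End gaussian_shift.

(** * Boxes in the space of observations *)

Section observations.
Variables (R : realType) (n L : nat).

Notation obs := (g_sigma_algebraType (@obs_cylinders R n L)).

(** Boxes generate the same sigma-algebra as the cylinders and form a pi-system, which cylinders in
    general do not. *)
Definition obs_boxes : set (set ('I_L -> 'M[R]_n)) :=
  [set A | exists2 B : 'I_L -> 'I_n -> 'I_n -> set R,
     (forall l i j, measurable (B l i j)) &
     A = [set M : 'I_L -> 'M[R]_n | forall l i j, B l i j (M l i j)]].

Lemma measurable_obs_entry (l : 'I_L) (i j : 'I_n) :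
  measurable_fun [set: obs] (fun A : obs => (A : 'I_L -> 'M[R]_n) l i j : R).
Proof.
move=> _ B mB; apply: sub_sigma_algebra; exists (l, (i, j)) => //.
by exists B.
Qed.

Lemma measurable_to_obs d (T : measurableType d) (f : T -> 'I_L -> 'M[R]_n) :
  (forall l i j, measurable_fun setT (fun w => f w l i j)) ->
  measurable_fun setT (f : T -> obs).
Proof.
move=> mf; apply: (@measurability _ _ T obs setT f (@obs_cylinders R n L)) => //.
move=> _ [_ [[l [i j]] _ [B mB <-]] <-].
rewrite setTI; exact: mf.
Qed.

Lemma obs_boxesE : @measurable _ obs = <<s obs_boxes >>.
Proof.
apply/seteqP; split; apply: smallest_sub; try exact: smallest_sigma_algebra.
- move=> _ [[l [i j]] _ [B mB <-]]; apply: sub_sigma_algebra.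
  exists (fun l' i' j' => if (l', i', j') == (l, i, j) then B else setT).
    by move=> l' i' j'; case: ifP.
  rewrite setTI; apply/seteqP; split=> [M /= MB l' i' j'|M /= /(_ l i j)].
    by case: ifPn => // /eqP[-> -> ->].
  by rewrite eqxx.
- move=> _ [B mB ->].
  have -> : [set M : 'I_L -> 'M[R]_n | forall l i j, B l i j (M l i j)] =
      \bigcap_(k : 'I_L * ('I_n * 'I_n))
        ((fun M : obs => (M : 'I_L -> 'M[R]_n) k.1 k.2.1 k.2.2) @^-1` B k.1 k.2.1 k.2.2).
    apply/seteqP; split=> M /= MB; first by move=> k _; exact: MB.
    by move=> l i j; exact: (MB (l, (i, j))).
  apply: (@fin_bigcap_measurable _ obs) => // k _.
  rewrite -[X in measurable X]setTI; apply: measurable_obs_entry => //.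
Qed.

Lemma obs_boxes_setI : setI_closed obs_boxes.
Proof.
move=> _ _ [B mB ->] [C mC ->]; exists (fun l i j => B l i j `&` C l i j).
  by move=> l i j; exact: measurableI.
apply/seteqP; split=> M /=; first by move=> [h1 h2] l i j; split.
by move=> h; split=> l i j; have [] := h l i j.
Qed.

Lemma obs_boxes_setT : obs_boxes setT.
Proof. by exists (fun _ _ _ => setT) => //; apply/seteqP; split. Qed.

(** An entry and its mirror image coincide, so the two sides of the box that constrain them are
    intersected. This reduces boxes to the independent coordinates. *)
Lemma symmetric_boxP (B : 'I_L -> 'I_n -> 'I_n -> set R) (M : 'I_L -> 'M[R]_n) :
  (forall l, (M l)^T = M l) ->
  (forall l i j, B l i j (M l i j)) <->
  (forall k : 'I_L * upper_index n,
    (B k.1 (val k.2).1 (val k.2).2 `&` B k.1 (val k.2).2 (val k.2).1)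
      (M k.1 (val k.2).1 (val k.2).2)).
Proof.
move=> MT; have Msym l i j : M l i j = M l j i by rewrite -{1}MT mxE.
split=> [MB [l u]/=|MB l i j]; first by split=> //; rewrite Msym.
have [ij|/ltnW ji] := leqP i j.
  by have [] := MB (l, exist _ (i, j) ij).
by rewrite Msym; have [] := MB (l, exist _ (j, i) ji).
Qed.

(** The weight 2 counts both copies of an off-diagonal entry. It matches the halved variance of that
    entry, so that Gaussian exponents become Frobenius norms. *)
Lemma sum_upper_index (M : 'M[R]_n) : M^T = M ->
  \sum_(u : upper_index n)
     (if (val u).1 == (val u).2 then 1 else 2) * M (val u).1 (val u).2 ^+ 2 =
  sqn M.
Proof.
move=> MT; have Msym i j : M i j = M j i by rewrite -{1}MT mxE.
pose F (p : 'I_n * 'I_n) := (if p.1 == p.2 then 1 else 2) * M p.1 p.2 ^+ 2.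
rewrite -(big_sub [pred p : 'I_n * 'I_n | (p.1 <= p.2)%N] F).
rewrite sqnE pair_big /= [RHS](bigID (fun p : 'I_n * 'I_n => (p.1 <= p.2)%N)) /=.
pose swap (p : 'I_n * 'I_n) := (p.2, p.1).
have swapK : involutive swap by case.
rewrite [X in _ = _ + X](reindex_inj (inv_inj swapK)) /=.
rewrite [X in _ = _ + X]big_mkcond [X in _ = X + _]big_mkcond [LHS]big_mkcond /=.
rewrite -big_split; apply: eq_bigr => -[i j] _.
rewrite inE /F /= -ltnNge -(inj_eq val_inj) /= (Msym j i).
by case: ltngtP => _ /=; ring.
Qed.

End observations.

(** * Likelihood ratios under GOE noise *)

Section shifted_noise.
Context d (T : measurableType d) (R : realType) (P : probability T R).
Variables (n L : nat) (sigma : R) (N : 'I_L -> T -> 'M[R]_n).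
Hypotheses (sigma0 : 0 < sigma) (NGOE : GOE_noise P sigma N).

Local Notation obs := (g_sigma_algebraType (@obs_cylinders R n L)).
Local Notation idx := ('I_L * upper_index n)%type.
Local Notation row k := (val k.2).1.
Local Notation col k := (val k.2).2.
Implicit Types (k : idx) (S : 'I_L -> 'M[R]_n).

Definition noise_coord k (w : T) : R := N k.1 w (row k) (col k).

Definition noise_var k : R := if row k == col k then sigma ^+ 2 else sigma ^+ 2 / 2.

(** The likelihood ratio of signal [S] against zero signal, evaluated at the pure noise; the product
    runs over the independent coordinates only. *)
Definition likelihood S (w : T) : R :=
  \prod_k tilt (noise_var k) (S k.1 (row k) (col k)) (noise_coord k w).

Lemma noise_var_gt0 k : 0 < noise_var k.
Proof. by rewrite /noise_var; case: ifP => _; rewrite ?divr_gt0// exprn_gt0. Qed.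

Lemma noise_coord_gaussian k : centered_gaussian P (noise_var k) (noise_coord k).
Proof. by case: NGOE => /(_ k.1) [_ + _] _; apply; exact: (valP k.2). Qed.

Lemma measurable_noise_coord k : measurable_fun setT (noise_coord k).
Proof. by case: (noise_coord_gaussian k). Qed.

Lemma noise_tr l w : (N l w)^T = N l w.
Proof. by case: NGOE => /(_ l) [+ _ _] _; apply. Qed.

Lemma measurable_noise l i j : measurable_fun setT (fun w => N l w i j).
Proof.
have [ij|/ltnW ji] := leqP i j.
  exact: (measurable_noise_coord (l, exist _ (i, j) ij)).
apply: (eq_measurable_fun (fun w => N l w j i)) => [w _|].
  by rewrite -[in LHS]noise_tr mxE.
exact: (measurable_noise_coord (l, exist _ (j, i) ji)).
Qed.

(** Independence is used at two levels: between the matrices [N l], through their sigma-algebras,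
    and then between the upper entries of each. *)
Lemma noise_coord_indep (B : idx -> set R) : (forall k, measurable (B k)) ->
  P (\bigcap_k (noise_coord k @^-1` B k)) =
  (\prod_k P (noise_coord k @^-1` B k))%E.
Proof.
move=> mB; case: NGOE => NG Nindep.
pose D l := \bigcap_(u : upper_index n) (noise_coord (l, u) @^-1` B (l, u)).
have -> : \bigcap_k (noise_coord k @^-1` B k) = \bigcap_(l in [set` [set: 'I_L]%SET]) D l.
  apply/seteqP; split=> [w h l _ u _|w h [l u] _]; first exact: h.
  by apply: (h l) => //=; rewrite inE.
rewrite Nindep; last first.
  move=> l _; rewrite /D /sigma_algebra_of_mx.
  pose G := \bigcup_(ij in [set: 'I_n * 'I_n])
        preimage_set_system setT (fun w => N l w ij.1 ij.2) (@measurable _ R).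
  apply: (@fin_bigcap_measurable _ (g_sigma_algebraType G)); first exact: finite_finset.
  move=> u _.
  apply: sub_sigma_algebra; exists (val u) => //; exists (B (l, u)) => //.
  by rewrite setTI.
rewrite (eq_bigl xpredT); last by move=> l; rewrite inE.
transitivity (\prod_l \prod_u P (noise_coord (l, u) @^-1` B (l, u)))%E; last first.
  by rewrite pair_bigA; apply: eq_bigr => -[l u].
apply: eq_bigr => l _; have [_ _ indl] := NG l.
have -> : D l = \bigcap_(u in [set` [set: upper_index n]%SET])
    (noise_coord (l, u) @^-1` B (l, u)).
  by apply/seteqP; split=> w h u _; apply: h => //=; rewrite inE.
rewrite indl; last first.
  by move=> u _; exists (B (l, u)) => //; rewrite setTI.
by apply: eq_bigl => u; rewrite inE.
Qed.

Lemma likelihood_ge0 S w : 0 <= likelihood S w.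
Proof. by apply: prodr_ge0 => k _; exact: expR_ge0. Qed.

Lemma measurable_likelihood S : measurable_fun setT (likelihood S).
Proof.
apply: measurable_prod => k _.
by apply: (measurableT_comp (measurable_tilt _ _)); exact: measurable_noise_coord.
Qed.

Lemma integral_likelihood S : (\int[P]_w (likelihood S w)%:E = 1)%E.
Proof.
rewrite (@expectation_prod _ _ _ _ _ _ measurable_noise_coord noise_coord_indep
  (fun k => tilt (noise_var k) (S k.1 (row k) (col k))) (fun=> 1)).
- by rewrite big1.
- by move=> k; exact: measurable_tilt.
- by move=> k x; exact: expR_ge0.
- by move=> k; apply: integral_tilt; [exact: noise_var_gt0|exact: noise_coord_gaussian].
Qed.

Lemma measurable_shifted_noise S :
  measurable_fun setT ((fun w l => S l + N l w) : T -> obs).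
Proof.
apply: (@measurable_to_obs R n L _ T) => l i j; under eq_fun do rewrite mxE.
by apply: measurable_funD => //; exact: measurable_noise.
Qed.

Lemma measurable_noise_obs : measurable_fun setT ((fun w l => N l w) : T -> obs).
Proof. by apply: (@measurable_to_obs R n L _ T) => l i j; exact: measurable_noise. Qed.

(** The law of [S + N] and the law of [N] weighted by the likelihood need only be compared on boxes.
    There both factor over the coordinates, and [gaussian_shift] equates the factors. Symmetry of
    [S] keeps [S + N] symmetric. *)
Lemma change_of_measure S (f : obs -> R) :
  (forall l, (S l)^T = S l) -> measurable_fun setT f -> (forall A, 0 <= f A) ->
  (\int[P]_w (f (fun l => S l + N l w)%R)%:E =
   \int[P]_w (f (fun l => N l w) * likelihood S w)%:E)%E.
Proof.
move=> ST mf f0.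
rewrite -(@integral_transfer _ _ _ obs R P (fun w l => S l + N l w) _ (cst 1))//;
  first (by apply: eq_integral => w _; rewrite mulr1);
  [exact: measurable_shifted_noise | exact: measurable_noise_obs
  | exact: measurable_likelihood | exact: likelihood_ge0 |].
have m1 : measurable_fun setT (cst 1 : T -> R) by exact: measurable_cst.
refine (@weighted_image_unique _ _ _ obs R P _ _ _ _ (measurable_shifted_noise S)
  measurable_noise_obs m1 (measurable_likelihood S) (fun=> ler01)
  (likelihood_ge0 S) (@obs_boxes R n L) (@obs_boxesE R n L) (@obs_boxes_setI R n L)
  (@obs_boxes_setT R n L) _ _).
  rewrite /weighted_image preimage_setT.
  have -> : (\int[P]_w (cst 1 w)%:E = 1 * P setT)%E.
    by rewrite -(integral_cst P measurableT 1%E).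
  by rewrite probability_setT mul1e.
move=> _ [B mB ->]; rewrite /weighted_image.
pose C k := B k.1 (row k) (col k) `&` B k.1 (col k) (row k).
have mC k : measurable (C k) by exact: measurableI.
pose s k := S k.1 (row k) (col k).
have entryE k w : noise_coord k w + s k = (S k.1 + N k.1 w) (row k) (col k).
  by rewrite mxE addrC.
have -> : (fun w l => S l + N l w) @^-1` [set M | forall l i j, B l i j (M l i j)] =
    \bigcap_k (noise_coord k @^-1` ((fun x => x + s k) @^-1` C k)).
  apply/seteqP; split=> w /=.
    move/(symmetric_boxP B) => h k _; rewrite /preimage /= entryE; apply: h.
    by move=> l; rewrite linearD /= ST noise_tr.
  move=> h; apply/(symmetric_boxP B) => [l|k].
    by rewrite linearD /= ST noise_tr.
  by rewrite -entryE; exact: h.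
have mCs k : measurable ((fun x => x + s k) @^-1` C k).
  by rewrite -[X in measurable X]setTI; apply: measurable_funD.
have mD : measurable (\bigcap_k (noise_coord k @^-1` ((fun x => x + s k) @^-1` C k))).
  apply: fin_bigcap_measurable; [exact: finite_finset|move=> k _].
  by rewrite -[X in measurable X]setTI; apply: measurable_noise_coord.
transitivity (P (\bigcap_k (noise_coord k @^-1` ((fun x => x + s k) @^-1` C k)))).
  by rewrite -[RHS]mul1e -(integral_cst P mD 1%E).
rewrite noise_coord_indep//.
have -> : (fun w l => N l w) @^-1` [set M | forall l i j, B l i j (M l i j)] =
    \bigcap_k (noise_coord k @^-1` C k).
  apply/seteqP; split=> w /=.
    by move/(symmetric_boxP B) => h k _; apply: h => l; rewrite noise_tr.
  move=> h; apply/(symmetric_boxP B) => [l|k]; first by rewrite noise_tr.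
  exact: h.
rewrite integral_mkcond epatch_indic.
pose F k x := \1_(C k) x * tilt (noise_var k) (s k) x.
transitivity (\int[P]_w (\prod_k F k (noise_coord k w))%:E)%E; last first.
  apply: eq_integral => w _; rewrite -EFinM; congr EFin.
  by rewrite indic_bigcap big_split /= mulrC.
pose e k := fine (P (noise_coord k @^-1` ((fun x => x + s k) @^-1` C k))).
have Pe k : P (noise_coord k @^-1` ((fun x => x + s k) @^-1` C k)) = (e k)%:E.
  rewrite fineK// fin_num_measure// -[X in measurable X]setTI.
  exact: measurable_noise_coord.
rewrite (@expectation_prod _ _ _ _ _ _ measurable_noise_coord noise_coord_indep F e).
- by rewrite (eq_bigr _ (fun k _ => Pe k)) prodEFin.
- move=> k; apply: measurable_funM; first exact: measurable_indic.
  exact: measurable_tilt.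
- by move=> k x; rewrite mulr_ge0// expR_ge0.
- move=> k; rewrite -Pe.
  exact: (gaussian_shift (noise_var_gt0 k) (noise_coord_gaussian k) (s k) (mC k)).
Qed.

(** Coordinatewise, the terms linear in the noise agree, and [(s^2 + s'^2) / 2 - ((s + s') / 2)^2 =
    (s - s')^2 / 4] accounts for the exponential factor. *)
Lemma likelihood_midpoint S S' (w : T) :
  (forall l, (S l)^T = S l) -> (forall l, (S' l)^T = S' l) ->
  likelihood S w * likelihood S' w =
  (likelihood (fun l => 2^-1 *: (S l + S' l)) w *
   expR (- (\sum_l sqn (S l - S' l)) / (8 * sigma ^+ 2))) ^+ 2.
Proof.
move=> ST S'T.
pose D k := (S k.1 (row k) (col k) - S' k.1 (row k) (col k)) ^+ 2 / (8 * noise_var k).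
have -> : - (\sum_l sqn (S l - S' l)) / (8 * sigma ^+ 2) = \sum_k - D k.
  transitivity (\sum_l \sum_u - D (l, u)); last first.
    by rewrite pair_bigA; apply: eq_bigr => -[l u].
  rewrite mulNr mulr_suml -sumrN.
  apply: eq_bigr => l _; rewrite -sum_upper_index; last first.
    by rewrite linearB /= ST S'T.
  rewrite mulr_suml -sumrN; apply: eq_bigr => u _; rewrite /D /noise_var /= !mxE.
  by case: ifP => _; field; rewrite gt_eqF.
rewrite expR_sum -!big_split /= -prodrXl; apply: eq_bigr => k _.
rewrite /tilt /D !mxE -!expRD -expRM_natl; congr expR.
by field; rewrite gt_eqF// noise_var_gt0.
Qed.

End shifted_noise.

(** * The lower bound *)

Lemma lambda_min_scalar (R : realType) (r : nat) (a : R) : (0 < r)%N ->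
  lambda_min (a%:M : 'M[R]_r) = a.
Proof.
case: r => // r _; rewrite /lambda_min.
have -> : [set b : R | eigenvalue (a%:M : 'M[R]_r.+1) b] = [set a].
  apply/seteqP; split=> [b /= /eigenvalueP[v]|_ ->] /=.
    rewrite mul_mx_scalar => /eqP; rewrite -subr_eq0 -scalerBl scaler_eq0.
    by rewrite subr_eq0 => /orP[/eqP ->//|->].
  apply/eigenvalueP; exists (delta_mx 0 0); first by rewrite mul_mx_scalar.
  apply/eqP => /matrixP/(_ 0 0); rewrite !mxE !eqxx /= => /eqP.
  by rewrite oner_eq0.
exact: inf1.
Qed.

(** With [lambda%:M] as every inner matrix, the mean of the squares is the scalar matrix
    [lambda ^+ 2]. *)
Lemma param_space_projection (R : realType) (n r L : nat) (lambda : R)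
    (U : 'M[R]_(n, r)) : (0 < r)%N -> (0 < L)%N -> U^T *m U = 1%:M ->
  @param_space R n r L lambda (fun=> lambda *: (U *m U^T), U).
Proof.
move=> r0 L0 UU; split=> //; exists (fun=> lambda%:M); split.
- by move=> _; rewrite tr_scalar_mx.
- by move=> _; rewrite mul_mx_scalar scalemxAl.
- rewrite sumr_const card_ord -scalar_mxM -[X in _ *: X]scaler_nat scalerA mulVf ?scale1r.
    by rewrite lambda_min_scalar// expr2.
  by rewrite pnatr_eq0 -lt0n.
Qed.

(** By [sin_theta_sqr] the loss is a polynomial in the entries of the estimator. *)
Lemma measurable_loss (R : realType) (n r L : nat)
    (Uhat : ('I_L -> 'M[R]_n) -> 'M[R]_(n, r)) (U : 'M[R]_(n, r)) :
  estimators Uhat ->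
  measurable_fun [set: g_sigma_algebraType (@obs_cylinders R n L)]
    (fun A : g_sigma_algebraType (@obs_cylinders R n L) =>
       sin_theta_F (Uhat A) U ^+ 2).
Proof.
move=> [Uon mU].
have lossE A : sin_theta_F (Uhat A) U ^+ 2 =
    sqn U - \sum_i \sum_j (\sum_k Uhat A k i * U k j) ^+ 2.
  rewrite sin_theta_sqr ?(orthonormal_leq (Uon A))// (sqnE (_ *m _)).
  congr (_ - _); apply: eq_bigr => i _; apply: eq_bigr => j _.
  by rewrite mxE; congr (_ ^+ 2); apply: eq_bigr => k _; rewrite mxE.
have -> : (fun A : g_sigma_algebraType (@obs_cylinders R n L) =>
      sin_theta_F (Uhat A) U ^+ 2) =
    (fun A : g_sigma_algebraType (@obs_cylinders R n L) =>
      sqn U - \sum_i \sum_j (\sum_k Uhat A k i * U k j) ^+ 2).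
  by apply/funext => A; exact: lossE.
apply: measurable_funB => //; do 2 (apply: measurable_sum => ?).
apply: measurable_funX; apply: measurable_sum => k.
by apply: measurable_funM => //; exact: mU.
Qed.

(** * The hypercube of signals and its Bayes risk *)

Section minimax_lower_bound.
Context d (T : measurableType d) (R : realType) (P : probability T R).
Variables (r m L : nat) (lambda sigma b : R) (N : 'I_L -> T -> 'M[R]_(r + m)).
Hypotheses (r0 : (0 < r)%N) (m0 : (0 < m)%N) (L0 : (0 < L)%N).
Hypotheses (sigma0 : 0 < sigma) (NGOE : GOE_noise P sigma N).
Hypotheses (rm : (4 * r ^ 2 <= m)%N).
Hypotheses (b_op : 2 * m%:R * b ^+ 2 <= 1).
Hypotheses (b_info : 4 * L%:R * lambda ^+ 2 * b ^+ 2 <= sigma ^+ 2).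

Local Notation cube := {ffun 'I_m * 'I_r -> bool}.
Implicit Types (t : cube) (k : 'I_m * 'I_r).

(* The constraint [b_op] gives opnorm (Y t) <= 1 for good t; [b_info] bounds by
   2 the total squared distance, in units of sigma^2, between the signals of
   neighbouring vertices. *)
Let Y t : 'M[R]_(m, r) := b *: sign_mx R t.
Let U t : 'M[R]_(r + m, r) := projT1 (cid (exists_graph_basis (Y t))).
Let S t : 'I_L -> 'M[R]_(r + m) := fun=> lambda *: (U t *m (U t)^T).

Let graphU t : graph_basis (Y t) (U t).
Proof. by rewrite /U; case: cid. Qed.

Let S_tr t l : (S t l)^T = S t l.
Proof. by rewrite /S linearZ /= trmx_mul trmxK. Qed.

Let sqn_YB t t' : sqn (Y t - Y t') = 4 * b ^+ 2 * \sum_k (t k != t' k)%:R.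
Proof. by rewrite -scalerBr sqnZ sqn_sign_mxB mulrCA mulrA. Qed.

Let opbound_Y t : good R t -> opbound 1 (Y t).
Proof.
move=> gt v; rewrite -scalemxAl sqnZ mul1r.
have := ler_wpM2l (sqr_ge0 b) (opbound_sign_mx m0 gt v).
have := ler_wpM2r (sqn_ge0 v) b_op; lra.
Qed.

(** [t'] is the good vertex of least loss, so the triangle inequality bounds its squared distance to
    [U t] by 4 times the loss at [t]. The bi-Lipschitz bound then gives [4 b^2 h <= 16 loss], with
    [h] the Hamming distance. *)
Let loss_separation Uh : Uh^T *m Uh = 1%:M -> exists t',
  forall t, good R t ->
    b ^+ 2 / 4 * \sum_k (t' k != t k)%:R <= sin_theta_F Uh (U t) ^+ 2.
Proof.
move=> UhUh; have [t0 gt0|nogood] := pickP (@good R m r); last first.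
  by exists [ffun=> false] => t; rewrite nogood.
case: (@arg_minP _ R _ t0 (@good R m r) (fun t => sin_theta_F Uh (U t) ^+ 2) gt0).
move=> t' gt' min_t'; exists t' => t gt.
have combine (h x y z : R) : x <= z -> y <= 2 * (x + z) ->
    4 * b ^+ 2 * h <= 4 * y -> b ^+ 2 / 4 * h <= z by lra.
apply: (combine _ _ _ _ (min_t' t gt)
  (sin_theta_triangle UhUh (graphU t').1 (graphU t).1)).
apply: le_trans (sin_theta_graph_ge (graphU t') (graphU t) (opbound_Y gt') (opbound_Y gt)).
by rewrite sqn_YB; under eq_bigr do rewrite eq_sym.
Qed.

(** [3 / 4] comes from [exp (- x) >= 1 - x] with [x <= 2 sigma^2 / (8 sigma^2)]. The midpoint need
    not be a signal of the parameter space; only its likelihood, a density of mass one, is used. *)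
Let likelihood_edge k t w :
  (3 / 4 * likelihood sigma N (fun l => 2^-1 *: (S t l + S (flip k t) l)) w) ^+ 2
  <= likelihood sigma N (S t) w * likelihood sigma N (S (flip k t)) w.
Proof.
rewrite likelihood_midpoint//.
rewrite ler_sqr ?nnegrE ?mulr_ge0 ?likelihood_ge0 ?expR_ge0//.
rewrite mulrC ler_wpM2l ?likelihood_ge0//.
apply: le_trans (expR_ge1Dx _).
have -> : \sum_l sqn (S t l - S (flip k t) l) =
    L%:R * (lambda ^+ 2 * (2 * sin_theta_F (U t) (U (flip k t)) ^+ 2)).
  rewrite /S sumr_const card_ord -[LHS]mulr_natl; congr (_ * _).
  by rewrite -scalerBr sqnZ sin_theta_proj_dist; [|exact: (graphU _).1..].
have := sin_theta_graph_le (graphU t) (graphU (flip k t)).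
rewrite sqn_YB (bigD1 k)//= big1 ?addr0; last first.
  by move=> i ik; rewrite ffunE (negbTE ik) addbF eqxx.
have -> : (flip k t k != t k)%:R = 1 :> R.
  by rewrite ffunE eqxx addbT; case: (t k).
move: (sin_theta_F _ _ ^+ 2) => x xb.
have : L%:R * lambda ^+ 2 * x <= L%:R * lambda ^+ 2 * (4 * b ^+ 2 * 1).
  by rewrite ler_wpM2l// mulr_ge0// sqr_ge0.
move=> xle; rewrite mulNr; set v := L%:R * _.
suff : v / (8 * sigma ^+ 2) <= 4^-1 by lra.
rewrite ler_pdivrMr ?mulr_gt0 ?exprn_gt0// /v.
have -> : L%:R * (lambda ^+ 2 * (2 * x)) = 2 * (L%:R * lambda ^+ 2 * x) by ring.
have e : L%:R * lambda ^+ 2 * (4 * b ^+ 2 * 1) = 4 * L%:R * lambda ^+ 2 * b ^+ 2 by ring.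
have scale (x1 x2 x3 s : R) : x1 <= x2 -> x2 = x3 -> x3 <= s ->
  2 * x1 <= 4^-1 * (8 * s) by lra.
exact: scale xle e b_info.
Qed.

(** The supremum dominates the risk at each good vertex, and Assouad's bound applies to the sum of
    these risks. *)
Lemma sup_risk_ge (Uhat : ('I_L -> 'M[R]_(r + m)) -> 'M[R]_(r + m, r)) :
  estimators Uhat ->
  ((b ^+ 2 * m%:R * r%:R / 64)%:E <=
    ereal_sup [set risk P N Uhat SU.1 SU.2 | SU in @param_space R (r + m) r L lambda])%E.
Proof.
move=> estU; set s := ereal_sup _.
have risk_le t : (risk P N Uhat (S t) (U t) <= s)%E.
  apply: ereal_sup_ubound; exists (S t, U t) => //.
  by apply: param_space_projection => //; exact: (graphU t).1.
pose loss t (w : T) := sin_theta_F (Uhat (fun l => N l w)) (U t) ^+ 2.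
have riskE t : risk P N Uhat (S t) (U t) =
    (\int[P]_w (loss t w * likelihood sigma N (S t) w)%:E)%E.
  rewrite /risk unlock.
  apply: (change_of_measure sigma0 NGOE (f := fun A => sin_theta_F (Uhat A) (U t) ^+ 2)) => //.
  - exact: measurable_loss.
  - by move=> A; exact: sqr_ge0.
have risk0 t : (0 <= risk P N Uhat (S t) (U t))%E.
  rewrite riskE; apply: integral_ge0 => w _.
  by rewrite lee_fin mulr_ge0 ?sqr_ge0// likelihood_ge0.
have s0 : (0 <= s)%E := le_trans (risk0 [ffun=> false]) (risk_le _).
have /choice[that thatP] : forall w, exists t', forall t, good R t ->
    b ^+ 2 / 4 * \sum_k (t' k != t k)%:R <= loss t w.
  by move=> w; apply: loss_separation; exact: estU.1.
have b4 : 0 <= b ^+ 2 / 4 by rewrite divr_ge0// sqr_ge0.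
have q0 : 0 <= 3 / 4 :> R by lra.
have mloss t : measurable_fun setT (loss t).
  exact: (measurableT_comp (measurable_loss (U t) estU) (measurable_noise_obs NGOE)).
have := assouad b4 q0 (fun t => measurable_likelihood NGOE (S t))
  (fun t w => likelihood_ge0 sigma N (S t) w)
  (fun t => integral_likelihood sigma0 NGOE (S t))
  (fun k t => measurable_likelihood NGOE (fun l => 2^-1 *: (S t l + S (flip k t) l)))
  (fun k t w => likelihood_ge0 sigma N _ w)
  (fun k t => integral_likelihood sigma0 NGOE _)
  likelihood_edge mloss (fun t w => sqr_ge0 _) (fun t w => thatP w t).
have := sum_good_edge_ge R m0 rm; set E := \sum_k _.
case: s s0 risk_le => [s| |//] s0 risk_le; last by rewrite leey.
have card_gt0 : 0 < #|{: cube}|%:R :> R.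
  by rewrite ltr0n; apply/card_gt0P; exists [ffun=> false].
have sum_le : \sum_(t : cube | good R t) s <= #|{: cube}|%:R * s.
  rewrite mulr_natl -sumr_const [leLHS]big_mkcond; apply: ler_sum => t _.
  by case: ifP.
move: (#|{: cube}|%:R : R) card_gt0 sum_le => M M0 sum_le edges bayes.
(* The constant is [b^2 / 32]; since [E] is at least [m r / 2] times the number of vertices, the
   final factor is [1 / 64]. *)
have : b ^+ 2 / 4 * (3 / 4 / 2 - 4^-1) * E <= \sum_(t : cube | good R t) s.
  rewrite -lee_fin; apply: (le_trans bayes); rewrite -sumEFin.
  by apply: lee_sum => t _; rewrite -riskE.
rewrite lee_fin => /le_trans/(_ sum_le) bayes_s.
rewrite -(ler_pM2r M0); have := ler_wpM2l b4 edges; lra.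
Qed.

End minimax_lower_bound.

Theorem theorem3 (R : realType) :
  exists c0 c : R, [/\ 0 < c0, 0 < c &
    forall (n r L : nat) (lambda sigma : R)
      (d : measure_display) (T : measurableType d) (P : probability T R)
      (N : 'I_L -> T -> 'M[R]_n),
      (0 < r)%N -> (0 < L)%N -> 0 < lambda -> 0 < sigma ->
      r%:R <= c0 * Num.sqrt n%:R ->
      GOE_noise P sigma N ->
      ((c * Num.min (sigma ^+ 2 * n%:R * r%:R / (lambda ^+ 2 * L%:R)) r%:R)%:E
        <= minimax_risk P r N lambda)%E].
Proof.
(* [1 / 4] yields [16 r^2 <= n], hence both [4 r^2 <= m] and [n <= 2 m]. The other constant is
   [1 / 512 = 1 / 8 * 1 / 64], from [b^2 m = rate / 8] and [sup_risk_ge]. *)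
exists 4^-1, 512^-1; split; [by rewrite invr_gt0 ltr0n|by rewrite invr_gt0 ltr0n|].
move=> n r L lambda sigma d T P N r0 L0 lambda0 sigma0 rn NGOE.
have rn16 : (16 * r ^ 2 <= n)%N.
  rewrite -(ler_nat R) natrM natrX -[leRHS]sqr_sqrtr//.
  have := ler_pM (ler0n R r) (ler0n R r) rn rn; lra.
have [m nE] : exists m, n = (r + m)%N.
  by exists (n - r)%N; rewrite subnKC//; nia.
subst n; have rm : (4 * r ^ 2 <= m)%N by nia.
have m0 : (0 < m)%N by nia.
have nm : ((r + m)%:R <= 2 * m%:R :> R) by rewrite -natrM ler_nat; nia.
have m0' : 0 < m%:R :> R by rewrite ltr0n.
have lL0 : 0 < lambda ^+ 2 * L%:R by rewrite mulr_gt0 ?exprn_gt0 ?ltr0n.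
pose rate := Num.min (sigma ^+ 2 * (r + m)%:R / (lambda ^+ 2 * L%:R)) 1.
have rate0 : 0 <= rate.
  by rewrite le_min ler01 divr_ge0 ?mulr_ge0 ?sqr_ge0// ltW.
have rate1 : rate <= 1 by rewrite ge_min lexx orbT.
have rateE : Num.min (sigma ^+ 2 * (r + m)%:R * r%:R / (lambda ^+ 2 * L%:R)) r%:R =
    rate * r%:R.
  by rewrite minr_pMl ?ler0n// mul1r mulrAC.
(* The factor 8 absorbs the 4 of the information constraint and the 2 of [n <= 2 m]; the operator
   norm constraint becomes [rate / 4 <= 1]. *)
pose b := Num.sqrt (rate / (8 * m%:R)).
have bE : b ^+ 2 = rate / (8 * m%:R).
  by rewrite sqr_sqrtr// divr_ge0// mulr_ge0.
have bm : b ^+ 2 * m%:R = rate / 8 by rewrite bE; field; rewrite gt_eqF.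
apply: le_ereal_inf_tmp => _ [Uhat estU <-].
have -> : 512^-1 * Num.min (sigma ^+ 2 * (r + m)%:R * r%:R / (lambda ^+ 2 * L%:R)) r%:R =
    b ^+ 2 * m%:R * r%:R / 64 by rewrite rateE bm; field.
apply: (sup_risk_ge _ _ _ sigma0 NGOE rm _ _ estU) => //; first by lra.
have h1 : rate * (lambda ^+ 2 * L%:R) <= sigma ^+ 2 * (r + m)%:R.
  by rewrite -ler_pdivlMr// ge_min lexx.
have h2 : sigma ^+ 2 * (r + m)%:R <= sigma ^+ 2 * (2 * m%:R).
  by rewrite ler_wpM2l// sqr_ge0.
have -> : 4 * L%:R * lambda ^+ 2 * b ^+ 2 = rate * (lambda ^+ 2 * L%:R) / (2 * m%:R).
  by rewrite bE; field; rewrite gt_eqF.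
by rewrite ler_pdivrMr ?mulr_gt0// (le_trans h1).
Qed.
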